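(* If $3\leq n\leq 5$, then any immersed $n$-gon in the plane is simple (i.e. embedded).
   Context: Let $\mathbb{D}\subset\mathbb{C}$ be the open unit disk, $\overline{\mathbb{D}}$ its closure and $S^1=\partial\mathbb{D}$. An immersed polygon in the plane is a closed polygonal curve $\phi:S^1\to\mathbb{C}$ (considered up to orientation-preserving reparametrization of $S^1$) which extends to an orientation-preserving local homeomorphism $f:\overline{\mathbb{D}}\to\mathbb{C}$; here local homeomorphism on the closed disk means that $f$ is continuous and every point of $\overline{\mathbb{D}}$ (including boundary points) has a neighborhood in $\overline{\mathbb{D}}$ that $f$ maps homeomorphically onto its image. An immersed $n$-gon is an immersed polygon $\phi$ for which there are distinct points $z_1,\ldots,z_n\in S^1$ in counter-clockwise order such that $\phi$ maps each component of $S^1\setminus\{z_1,\ldots,z_n\}$ (homeomorphically) to the interior of a straight line segment. The points $w_j=\phi(z_j)$ are its vertices; a priori some of them may coincide. The interior angle at $w_j$ is the clockwise angle $\angle w_{j-1}w_jw_{j+1}\in(0,2\pi)$ (indices modulo $n$); interior angles equal to $\pi$ are allowed. An immersed polygon $\phi$ is simple (or embedded) if $\phi:S^1\to\mathbb{C}$ is injective. *)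

(* Defs.v *)
From HB Require Import structures.
From mathcomp Require Import all_boot all_order all_algebra.
From mathcomp Require Import all_classical all_reals all_analysis.
From mathcomp Require Import complex.

Set Implicit Arguments.
Unset Strict Implicit.
Unset Printing Implicit Defensive.

Import Order.TTheory GRing.Theory Num.Theory numFieldNormedType.Exports.

Local Open Scope classical_set_scope.
Local Open Scope ring_scope.
Local Open Scope complex_scope.

(* The norm topology of the complex plane. Norms and radii live in R[i] itself;
   in its partial order, 0 < e means that e is real and positive. *)
HB.instance Definition _ (R : realType) := NormedModule.copy R[i] R[i]^o.

Section Homeomorphisms.
Context {T U : topologicalType}.

(* f restricts to a homeomorphism from the subspace A onto the subspace B. *)
Definition homeomorphism_on (A : set T) (B : set U) (f : T -> U) : Prop :=
  [/\ set_bij A B f,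
      {within A, continuous f} &
      exists g : U -> T, {within B, continuous g} /\ {in A, cancel f g}].

(* Neighborhoods of z in the subspace D are taken of the form V `&` D. *)
Definition local_homeomorphism_on (D : set T) (f : T -> U) : Prop :=
  {within D, continuous f} /\
  forall z, D z -> exists2 V : set T, nbhs z V &
    homeomorphism_on (V `&` D) (f @` (V `&` D)) f.

End Homeomorphisms.

Section Plane.
Context {R : realType}.

Definition unit_disk : set R[i] := [set z | `|z| < 1].
Definition closed_unit_disk : set R[i] := [set z | `|z| <= 1].
Definition unit_circle : set R[i] := [set z | `|z| = 1].

Definition cis (t : R) : R[i] := cos t +i* sin t.

(* theta is a continuous choice of the argument of gamma t - p along
   [0, 2 pi]; its total variation is 2 pi times the winding number. *)
Definition has_winding_number (gamma : R -> R[i]) (p : R[i]) (k : int) : Prop :=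
  exists theta : R -> R,
    [/\ {within `[0, 2 * pi], continuous theta},
        forall t, t \in `[0, 2 * pi] ->
          gamma t != p /\ gamma t - p = `|gamma t - p| * cis (theta t) &
        theta (2 * pi) - theta 0 = 2 * pi * k%:~R].

(* Local degree 1 at every point of the open disk. *)
Definition orientation_preserving (f : R[i] -> R[i]) : Prop :=
  forall z, unit_disk z -> \forall r \near (0 : R)^'+,
    has_winding_number (fun t => f (z + r%:C * cis t)) (f z) 1.

Definition disk_immersion (f : R[i] -> R[i]) : Prop :=
  local_homeomorphism_on closed_unit_disk f /\ orientation_preserving f.

(* The interior of the segment [a, b]. *)
Definition open_segment (a b : R[i]) : set R[i] :=
  [set a + s%:C * (b - a) | s in `]0, 1[%classic].

(* One counter-clockwise turn starting at the first point meets the points in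
   the order of their indices; the arguments may be shifted by any constant. *)
Definition counterclockwise (n : nat) (z : 'I_n -> R[i]) : Prop :=
  exists t : 'I_n -> R,
    [/\ forall j, z j = cis (t j),
        forall j k : 'I_n, (j < k)%N -> t j < t k &
        forall j k : 'I_n, t k < t j + 2 * pi].

(* A curve on the unit circle is a function on the plane of which only the
   restriction to the unit circle matters. *)
Definition n_sided (n : nat) (phi : R[i] -> R[i]) : Prop :=
  exists z : 'I_n -> R[i],
    [/\ injective z,
        counterclockwise z &
        forall x, (unit_circle `\` range z) x ->
          exists a b, a != b /\
            homeomorphism_on (connected_component (unit_circle `\` range z) x)
              (open_segment a b) phi].

Definition closed_polygonal_curve (phi : R[i] -> R[i]) : Prop :=
  {within unit_circle, continuous phi} /\ exists m : nat, n_sided m phi.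

Definition immersed_polygon (phi : R[i] -> R[i]) : Prop :=
  closed_polygonal_curve phi /\
  exists f : R[i] -> R[i], disk_immersion f /\ {in unit_circle, f =1 phi}.

Definition immersed_ngon (n : nat) (phi : R[i] -> R[i]) : Prop :=
  immersed_polygon phi /\ n_sided n phi.

Definition simple_curve (phi : R[i] -> R[i]) : Prop :=
  {in unit_circle &, injective phi}.

End Plane.

(* Main.v *)
(* Lift the segments issuing from a point of the disk through f; a boundary point
   is visible from x if it is the end of a lifted segment starting at x. A ray
   lifted from an interior point always ends at a boundary point.

   Suppose f y1 = f y2 = q for distinct interior points y1 and y2, where q may be
   taken generic. A generic line through q meets the boundary polygon in an even
   number of points, so in at most 4 of them as n <= 5, and the ends of its two
   rays lifted from y1 and from y2 are already 4 distinct such points. Hence every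
   boundary point is visible from y1 or y2. The two sets of visible points are
   closed, nonempty and disjoint (lifts are unique), which contradicts the
   connectedness of the circle: f is injective on the open disk.

   It follows that f maps no boundary point into the image of the open disk. As
   that image contains one side of each edge near each of its points, two edges
   cannot cross. The absence of spikes excludes the other double points of the
   boundary, except for a vertex of a pentagon lying on the opposite edge. Then
   the whole polygon lies on one side of the line of this edge, while the image of
   the disk contains points of the other side, from which a ray perpendicular to
   the edge has nowhere to end. *)

Require Import Defs.
From mathcomp Require Import all_boot all_order all_algebra.
From mathcomp Require Import all_classical all_reals all_analysis.
From mathcomp Require Import complex.
From mathcomp Require Import ring lra zify.

Set Implicit Arguments.
Unset Strict Implicit.
Unset Printing Implicit Defensive.

Import Order.TTheory GRing.Theory Num.Theory numFieldNormedType.Exports.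
Import Normc.

Local Open Scope classical_set_scope.
Local Open Scope ring_scope.
Local Open Scope complex_scope.

Arguments normc : simpl never.

(** * Norms and compactness *)

Section ComplexNorm.
Context {R : realType}.
Implicit Types (x y z : R[i]) (r : R).

(** The norm of [R[i]] is itself complex-valued. Everything below is measured by the real-valued
    [normc], on which real inequalities can be solved. *)
Lemma normCE z : `|z| = (normc z)%:C.
Proof. by rewrite normc_def; case: z. Qed.

Lemma normc_ge0 z : 0 <= normc z.
Proof. by case: z => a b; exact: sqrtr_ge0. Qed.

Lemma normc_eq0 z : (normc z == 0) = (z == 0).
Proof.
by apply/eqP/eqP => [/eq0_normc|->]; rewrite ?normc0.
Qed.

Lemma normc_gt0 z : (0 < normc z) = (z != 0).
Proof. by rewrite lt_def normc_eq0 normc_ge0 andbT. Qed.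

Lemma normcBC x y : normc (x - y) = normc (y - x).
Proof. by rewrite -normcN opprB. Qed.

Lemma normcB_eq0 x y : normc (x - y) = 0 -> x = y.
Proof. by move/eq0_normc/eqP; rewrite subr_eq0 => /eqP. Qed.

Lemma normcB_le0 x y : normc (x - y) <= 0 -> x = y.
Proof.
by move=> h; apply: normcB_eq0; apply/eqP; rewrite eq_le h normc_ge0.
Qed.

Lemma normc_triangle z x y : normc (x - y) <= normc (x - z) + normc (z - y).
Proof. by have := le_normcD (x - z) (z - y); rewrite addrA subrK. Qed.

Lemma normc_real r : normc r%:C = `|r|.
Proof. by rewrite /normc /= expr0n /= addr0 sqrtr_sqr. Qed.

Lemma normcZ r z : normc (r%:C * z) = `|r| * normc z.
Proof. by rewrite normcM normc_real. Qed.

Lemma Re_le_normc z : `|complex.Re z| <= normc z.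
Proof. by have := normc_ge_Re z; rewrite normCE lecR. Qed.

Lemma Im_le_normc z : `|complex.Im z| <= normc z.
Proof.
case: z => a b; rewrite /normc /= -sqrtr_sqr ler_sqrt ?lerDr ?sqr_ge0 //.
by rewrite addr_ge0 ?sqr_ge0.
Qed.

Lemma normc_le_ReIm z : normc z <= `|complex.Re z| + `|complex.Im z|.
Proof.
case: z => a b; rewrite /normc /=.
rewrite -[leRHS]ger0_norm ?addr_ge0 // -sqrtr_sqr ler_sqrt ?sqr_ge0 //.
rewrite sqrrD !real_normK ?num_real // lerD2r lerDl.
by rewrite mulrn_wge0 // mulr_ge0.
Qed.

Lemma ReB x y : complex.Re (x - y) = complex.Re x - complex.Re y.
Proof. by case: x y => [a b] [c d]. Qed.

Lemma ImB x y : complex.Im (x - y) = complex.Im x - complex.Im y.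
Proof. by case: x y => [a b] [c d]. Qed.

Lemma normc_cis r : normc (cis r) = 1.
Proof. by rewrite /cis /normc /= cos2Dsin2 sqrtr1. Qed.

Lemma eq_normc_small x y : (forall e : R, 0 < e -> normc (x - y) <= e) -> x = y.
Proof.
move=> h; apply: normcB_le0.
by apply/ler_addgt0Pl => e e0; rewrite addr0; exact: h.
Qed.

Lemma nbhs_normc x (A : set R[i]) : nbhs x A <->
  exists2 e : R, 0 < e & forall y, normc (y - x) < e -> A y.
Proof.
split.
  move=> /nbhs_ballP[d /= d0 h].
  (* The radius [d] lives in [R[i]]; being positive, it equals its real part. *)
  have dE : d = (complex.Re d)%:C.
    by apply/eqP; rewrite eq_complex /= eqxx (ger0_Im (ltW d0)) eqxx.
  rewrite dE in h d0; rewrite ltcR in d0.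
  exists (complex.Re d) => // y yx; apply: h.
  by rewrite -ball_normE /= normCE ltcR normcBC.
move=> [e e0 h]; apply/nbhs_ballP; exists e%:C; first by rewrite /= ltcR.
by move=> y; rewrite -ball_normE /= normCE ltcR normcBC => /h.
Qed.

Lemma cvg_normc (T : Type) (F : set_system T) (FF : Filter F) (u : T -> R[i]) z :
  u @ F --> z <-> forall e : R, 0 < e -> \forall t \near F, normc (u t - z) < e.
Proof.
split.
  by move=> h e e0; apply: (h [set y | normc (y - z) < e]); apply/nbhs_normc; exists e.
move=> h A /nbhs_normc[e e0 eA]; apply: filterS (h e e0) => t; exact: eA.
Qed.

Lemma unit_circleP x : unit_circle x <-> normc x = 1.
Proof.
rewrite /unit_circle /= normCE; split => [|->//].
exact: (@complexI _ (normc x) 1).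
Qed.

Lemma closed_unit_diskP x : closed_unit_disk x <-> normc x <= 1.
Proof. by rewrite /closed_unit_disk /= normCE (lecR (normc x) 1). Qed.

Lemma unit_diskP x : unit_disk x <-> normc x < 1.
Proof. by rewrite /unit_disk /= normCE (ltcR (normc x) 1). Qed.

End ComplexNorm.

(** * Limits along a free ultrafilter *)

Section Ultralimits.
Context {R : realType}.

(** Limits along such an ultrafilter replace the extraction of subsequences: a single [U] serves all
    bounded sequences at once, even uncountably many of them. *)
Lemma free_ultrafilter : exists U : set_system nat,
  UltraFilter U /\ forall n, U [set m | (n <= m)%N].
Proof.
have [U [uU oU]] := ultraFilterLemma (F := \oo) _.
by exists U; split => // n; apply: oU; exact: nbhs_infty_ge.
Qed.

Context (U : set_system nat) {UU : UltraFilter U}.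

(** The image of [U] under [u] is an ultrafilter containing the compact segment [[-M, M]]. *)
Lemma ultra_real_limit (u : nat -> R) (M : R) : (forall n, `|u n| <= M) ->
  exists l : R, forall e : R, 0 < e -> U [set n | `|u n - l| < e].
Proof.
move=> uM; have := @segment_compact R (- M) M; rewrite compact_ultra => cpt.
have uU : UltraFilter (u @ U).
  split; first exact: fmap_proper_filter.
  move=> G GG uG; apply/seteqP; split => // B GB.
  have [//|UB] := in_ultra_setVsetC (u @^-1` B) UU.
  have /(filterI GB) : G (~` B) by exact: uG.
  by rewrite setICr => /filter_not_empty.
have [|l [_ ul]] := cpt (u @ U) uU.
  apply: (@filterE nat U) => n /=.
  by rewrite in_itv /= -ler_norml.
exists l => e e0; apply: (ul [set y | `|y - l| < e]).
by apply/nbhs_ballP; exists e => //= y; rewrite /ball /= distrC.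
Qed.

Lemma ultra_disk_limit (x : nat -> R[i]) : (forall n, normc (x n) <= 1) ->
  exists l, normc l <= 1 /\ forall e : R, 0 < e -> U [set n | normc (x n - l) < e].
Proof.
move=> x1.
have [|a ha] := @ultra_real_limit (fun n => complex.Re (x n)) 1.
  by move=> n; exact: le_trans (Re_le_normc _) _.
have [|b hb] := @ultra_real_limit (fun n => complex.Im (x n)) 1.
  by move=> n; exact: le_trans (Im_le_normc _) _.
have lim (e : R) : 0 < e -> U [set n | normc (x n - (a +i* b)) < e].
  move=> e0; have e2 : 0 < e / 2 by lra.
  apply: filterS (filterI (ha _ e2) (hb _ e2)) => n /= [h1 h2].
  have := normc_le_ReIm (x n - (a +i* b)); rewrite ReB ImB.
  move: h1 h2 => /=; move: `|_| `|_| => p q; lra.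
exists (a +i* b); split => //.
apply/ler_addgt0Pl => e /lim /filter_ex [n /= h].
have := normc_triangle (x n) (a +i* b) 0; rewrite !subr0 normcBC.
move: h (x1 n); lra.
Qed.

End Ultralimits.

(** * Uniform estimates on the closed disk *)

Section Compactness.
Context {R : realType} (f : R[i] -> R[i]).
Implicit Types (x y z : R[i]).

Definition disk_continuous := forall x, normc x <= 1 -> forall e : R, 0 < e ->
  exists2 d : R, 0 < d &
    forall y, normc y <= 1 -> normc (y - x) < d -> normc (f y - f x) < e.

Definition disk_locally_injective := forall x, normc x <= 1 ->
  exists2 d : R, 0 < d & forall y z, normc y <= 1 -> normc z <= 1 ->
    normc (y - x) < d -> normc (z - x) < d -> f y = f z -> y = z.

Hypothesis fcont : disk_continuous.

Lemma ultra_continuous (U : set_system nat) {UU : UltraFilter U}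
    (x : nat -> R[i]) l : (forall n, normc (x n) <= 1) -> normc l <= 1 ->
  (forall e : R, 0 < e -> U [set n | normc (x n - l) < e]) ->
  forall e : R, 0 < e -> U [set n | normc (f (x n) - f l) < e].
Proof.
move=> x1 l1 xl e e0; have [d d0 h] := fcont l1 e0.
by apply: filterS (xl d d0) => n; exact: h.
Qed.

Lemma inv_succ_small (e : R) : 0 < e ->
  exists n : nat, forall m, (n <= m)%N -> m.+1%:R^-1 < e.
Proof.
move=> e0; have [n hn] : exists n : nat, e^-1 < n%:R.
  by exists (Num.bound e^-1); apply: archi_boundP; rewrite invr_ge0 ltW.
exists n => m nm; rewrite invf_plt ?posrE ?ltr0n //.
by apply: lt_le_trans hn _; rewrite ler_nat ltnW.
Qed.

(** The common source of the uniform constants below: a property that holds near each pair for all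
    small scales [a] holds for all pairs at one scale. Otherwise counterexamples at the scales
    [n.+1%:R^-1] have a limit pair along [U], near which the property holds. *)
Lemma disk_pairs_compact (P : R -> R[i] -> R[i] -> Prop) :
  (forall x y, normc x <= 1 -> normc y <= 1 ->
    exists2 d : R, 0 < d & forall a x' y', 0 < a < d ->
      normc x' <= 1 -> normc y' <= 1 ->
      normc (x' - x) < d -> normc (y' - y) < d -> P a x' y') ->
  exists2 a : R, 0 < a & forall x y, normc x <= 1 -> normc y <= 1 -> P a x y.
Proof.
move=> h; apply: contrapT => nP.
have bad n : exists q : R[i] * R[i], [/\ normc q.1 <= 1, normc q.2 <= 1 &
    ~ P n.+1%:R^-1 q.1 q.2].
  apply: contrapT => nq; apply: nP; exists n.+1%:R^-1; first by rewrite invr_gt0.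
  move=> x y x1 y1; apply: contrapT => nPxy; apply: nq.
  by exists (x, y); split.
have [q hq] := choice bad.
have [U [UU Uoo]] := free_ultrafilter.
have [|x [x1 qx]] := @ultra_disk_limit R U UU (fun n => (q n).1).
  by move=> n; have [] := hq n.
have [|y [y1 qy]] := @ultra_disk_limit R U UU (fun n => (q n).2).
  by move=> n; have [] := hq n.
have [d d0 hd] := h x y x1 y1.
have [N hN] := inv_succ_small d0.
have [n /= [[h1 h2] h3]] := filter_ex (filterI (filterI (qx d d0) (qy d d0)) (Uoo N)).
have [n1 n2] := hq n; apply; apply: hd => //.
by rewrite invr_gt0 ltr0n /= hN.
Qed.

Lemma disk_uniformly_continuous (e : R) : 0 < e -> exists2 d : R, 0 < d &
  forall x y, normc x <= 1 -> normc y <= 1 -> normc (x - y) < d ->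
    normc (f x - f y) < e.
Proof.
move=> e0; apply: disk_pairs_compact => x y x1 y1.
have e2 : 0 < e / 2 by lra.
have [dx dx0 hx] := fcont x1 e2; have [dy dy0 hy] := fcont y1 e2.
have [xy|/normcB_le0/esym xy] := ltP 0 (normc (x - y)); last first.
  subst y; exists dx => // a x' y' _ x'1 y'1 x'x y'x _.
  have := normc_triangle (f x) (f x') (f y').
  have := hx x' x'1 x'x; have := hx y' y'1 y'x.
  rewrite (normcBC (f x)); lra.
(* For [x] and [y] distinct, points within a third of their distance from them are farther apart
   than [a], so the premise fails. *)
exists (normc (x - y) / 3); first lra.
move=> a x' y' /andP[_ a1] _ _ x'x y'y x'y'.
have := normc_triangle x' x y; have := normc_triangle y' x' y.
rewrite (normcBC x x'); lra.
Qed.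

Lemma disk_image_bounded : exists2 M : R, 0 < M &
  forall x y, normc x <= 1 -> normc y <= 1 -> normc (f x - f y) <= M.
Proof.
(* The bound is written [a^-1] because the property must hold at every small scale [a]. *)
pose P a x y := normc (f x - f y) <= a^-1.
have [|a a0 h] := @disk_pairs_compact P.
  move=> x y x1 y1; have [dx dx0 hx] := fcont x1 ltr01.
  have [dy dy0 hy] := fcont y1 ltr01.
  pose K := normc (f x - f y) + 2.
  have K0 : 0 < K by have := normc_ge0 (f x - f y); rewrite /K; lra.
  exists (Num.min K^-1 (Num.min dx dy)).
    by rewrite !lt_min invr_gt0 K0 dx0.
  move=> a x' y' /andP[a0]; rewrite !lt_min => /and3P[aK _ _] x'1 y'1.
  move=> /and3P[_ x'x _] /and3P[_ _ y'y].
  apply: (@le_trans _ _ K).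
    have := normc_triangle (f x) (f x') (f y'); have := normc_triangle (f y) (f x) (f y').
    have := hx _ x'1 x'x; have := hy _ y'1 y'y; rewrite (normcBC (f y')) /K; lra.
  by rewrite -[K]invrK lef_pV2 ?posrE ?invr_gt0 // ltW.
by exists a^-1; rewrite ?invr_gt0.
Qed.

Hypothesis finj : disk_locally_injective.

Lemma disk_uniformly_injective : exists2 d : R, 0 < d &
  forall x y, normc x <= 1 -> normc y <= 1 -> normc (x - y) <= d ->
    f x = f y -> x = y.
Proof.
apply: disk_pairs_compact => x y x1 y1.
have [dx dx0 hx] := finj x1.
have [xy|/normcB_le0/esym xy] := ltP 0 (normc (x - y)); last first.
  exists dx => // a x' y' _ x'1 y'1 x'x y'x _; apply: hx => //.
  by rewrite -xy.
exists (normc (x - y) / 3); first lra.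
move=> a x' y' /andP[_ a1] _ _ x'x y'y x'y' _; exfalso.
have := normc_triangle x' x y; have := normc_triangle y' x' y.
rewrite (normcBC x x'); lra.
Qed.

(** Where [f] separates [x] and [y], images of nearby pairs stay farther apart than a small [a];
    elsewhere the injectivity radius [d] decides. *)
Lemma disk_inverse_uniformly_continuous (d e : R) : 0 < e ->
  (forall x y, normc x <= 1 -> normc y <= 1 -> normc (x - y) <= d ->
    f x = f y -> x = y) ->
  exists2 a : R, 0 < a & forall x y, normc x <= 1 -> normc y <= 1 ->
    normc (x - y) <= d -> normc (f x - f y) <= a -> normc (x - y) <= e.
Proof.
move=> e0 inj; apply: disk_pairs_compact => x y x1 y1.
pose near_pt k := fun x' y' => normc (x' - x) < k /\ normc (y' - y) < k.
have [fxy|/normcB_le0 fxy] := ltP 0 (normc (f x - f y)).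
  pose k := normc (f x - f y) / 3.
  have k0 : 0 < k by rewrite /k; lra.
  have [dx dx0 hx] := fcont x1 k0; have [dy dy0 hy] := fcont y1 k0.
  exists (Num.min k (Num.min dx dy)); first by rewrite !lt_min k0 dx0.
  move=> a x' y' /andP[a0]; rewrite !lt_min => /and3P[ak _ _] x'1 y'1.
  move=> /and3P[_ x'x _] /and3P[_ _ y'y] _ hf.
  have := hx _ x'1 x'x; have := hy _ y'1 y'y.
  have := normc_triangle (f x') (f x) (f y).
  have := normc_triangle (f y') (f x') (f y).
  rewrite (normcBC (f x) (f x')); move: ak; rewrite /k; lra.
(* Now [f x = f y]: either the pair is within [d], so that [x = y] and nearby pairs are within [e],
   or nearby pairs are farther apart than [d], too. *)
have [xyd|dxy] := leP (normc (x - y)) d.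
  have /esym yx := inj x y x1 y1 xyd fxy.
  exists (e / 2) => [|a x' y' _ _ _ x'x y'y _ _]; first lra.
  have := normc_triangle x x' y'; rewrite yx in y'y; rewrite (normcBC x); lra.
exists ((normc (x - y) - d) / 2) => [|a x' y' _ _ _ x'x y'y]; first lra.
have := normc_triangle x' x y; have := normc_triangle y' x' y.
rewrite (normcBC x x'); lra.
Qed.

End Compactness.

(** * Lifting segments *)

Section Lifts.
Context {R : realType} (f : R[i] -> R[i]).
Implicit Types (x y z b p : R[i]) (sg tau : R -> R[i]).

Definition disk_open_map := forall x, normc x < 1 -> forall e : R, 0 < e ->
  exists2 d : R, 0 < d & forall p, normc (p - f x) < d ->
    exists y, [/\ normc y < 1, normc (y - x) < e & f y = p].

(** [d] is an injectivity radius, and [4 * e <= d] leaves room to chain several jumps of size [e].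
    The last clause is relative to the length of an image segment: a parameter step of at most [k]
    along a lift over that segment moves the lift by at most [e], as soon as it moves it by at most
    [d]. *)
Definition lift_scale (d e k : R) := [/\ 0 < e, 4 * e <= d, 0 < k,
  (forall x y, normc x <= 1 -> normc y <= 1 -> normc (x - y) <= d ->
    f x = f y -> x = y) &
  (forall x y x' y', normc x <= 1 -> normc y <= 1 ->
    normc x' <= 1 -> normc y' <= 1 -> normc (x - y) <= d ->
    normc (f x - f y) <= k * normc (f x' - f y') -> normc (x - y) <= e)].

(* A lift need not be continuous: bounding its jumps by [e] is enough for
   uniqueness, and unlike continuity this bound survives pointwise limits. *)
Definition lift (e k : R) x b sg := [/\ sg 0 = x, sg 1 = b,
  (forall t : R, 0 <= t <= 1 ->
    normc (sg t) <= 1 /\ f (sg t) = f x + t%:C * (f b - f x)) &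
  (forall t t' : R, 0 <= t <= 1 -> 0 <= t' <= 1 -> `|t - t'| <= k ->
    normc (sg t - sg t') <= e)].

Definition visible (e k : R) x b := exists sg, lift e k x b sg.

Lemma lift_scale_exists : disk_continuous f -> disk_locally_injective f ->
  exists2 d, 0 < d &
    forall e, 0 < e -> 4 * e <= d -> exists k, lift_scale d e k.
Proof.
move=> fc fi; have [d d0 inj] := disk_uniformly_injective fi.
have [M M0 fM] := disk_image_bounded fc.
exists d => // e e0 ed.
have [a a0 ha] := disk_inverse_uniformly_continuous fc e0 inj.
(* [M] bounds the diameter of the image, so [a / M] times the length of an image segment is at most
   [a]. *)
exists (a / M); split => //; first by rewrite divr_gt0.
move=> x y x' y' x1 y1 x'1 y'1 xyd fxy; apply: ha => //.
apply: le_trans fxy _.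
by rewrite -[leRHS](divfK (lt0r_neq0 M0)) ler_wpM2l ?fM // ltW // divr_gt0.
Qed.

Context (d e k : R) (scale : lift_scale d e k).


(** Agreement spreads in parameter steps of length [k]: after one step the two lifts are at most
    [2 * e <= d] apart and have the same image, hence coincide. *)
Lemma lift_unique sg tau (t0 : R) : 0 <= t0 <= 1 ->
  (forall t : R, 0 <= t <= 1 ->
    [/\ normc (sg t) <= 1, normc (tau t) <= 1 & f (sg t) = f (tau t)]) ->
  (forall t t' : R, 0 <= t <= 1 -> 0 <= t' <= 1 -> `|t - t'| <= k ->
    normc (sg t - sg t') <= e /\ normc (tau t - tau t') <= e) ->
  sg t0 = tau t0 -> forall t : R, 0 <= t <= 1 -> sg t = tau t.
Proof.
move=> t01 fst cst st0 t t01'; have [e0 ed k0 inj _] := scale.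
have step (s s' : R) : 0 <= s <= 1 -> 0 <= s' <= 1 -> `|s - s'| <= k ->
    sg s = tau s -> sg s' = tau s'.
  move=> s1 s'1 ss' eqs.
  have [n1 n2 n3] := fst s' s'1; apply: inj => //.
  have [c1 c2] := cst _ _ s1 s'1 ss'.
  have := normc_triangle (sg s) (sg s') (tau s'); rewrite {2}eqs.
  rewrite (normcBC (sg s') (sg s)); lra.
have ind n : forall s : R, 0 <= s <= 1 -> `|s - t0| <= n%:R * k -> sg s = tau s.
  elim: n => [|n IH] s s1.
    rewrite mul0r normr_le0 subr_eq0 => /eqP->; exact: st0.
  rewrite -natr1 mulrDl mul1r => sn.
  have nk : 0 <= n%:R * k by rewrite mulr_ge0 // ltW.
  have := ler_norm (s - t0); have := ler_norm (t0 - s).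
  rewrite (distrC t0) => h1 h2.
  have [sk|sk] := leP `|s - t0| k.
    by apply: (step t0) => //; rewrite distrC.
  have [ts|ts] := leP t0 s.
    rewrite ger0_norm in sn sk; last lra.
    apply: (step (s - k)); [lra|lra| |].
      by rewrite addrAC subrr add0r normrN ger0_norm // ltW.
    apply: IH; first lra.
    by rewrite ger0_norm; lra.
  rewrite ler0_norm in sn sk; last lra.
  apply: (step (s + k)); [lra|lra| |].
    by rewrite addrAC subrr add0r ger0_norm // ltW.
  apply: IH; first lra.
  by rewrite ler0_norm; lra.
have [n hn] : exists n : nat, `|t - t0| / k < n%:R.
  by exists (Num.bound (`|t - t0| / k)); apply: archi_boundP; rewrite divr_ge0 // ltW.
by apply: (ind n) => //; rewrite -ler_pdivrMr // ltW.
Qed.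

(** Both lifts lie over the same segment and agree at parameter [1]; uniqueness carries the
    agreement back to parameter [0]. *)
Lemma visible_inj x y b : f x = f y -> visible e k x b -> visible e k y b -> x = y.
Proof.
move=> fxy [sg [sg0 sg1 sgf sgc]] [tau [tau0 tau1 tauf tauc]].
rewrite -sg0 -tau0; apply: (@lift_unique sg tau 1); rewrite ?lexx ?ler01 //.
- move=> t t1; have [? ->] := sgf t t1; have [? ->] := tauf t t1.
  by rewrite fxy.
- by move=> t t' t1 t'1 tt'; split; [exact: sgc | exact: tauc].
- by rewrite sg1 tau1.
Qed.

Hypothesis fcont : disk_continuous f.

(** Lifts ending at points that tend to [b] have a pointwise limit along a free ultrafilter, and the
    closed conditions in [lift] survive the limit. *)
Lemma visible_closed x b : normc b <= 1 ->
  (forall e1 : R, 0 < e1 ->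
    exists b', [/\ normc b' <= 1, normc (b' - b) < e1 & visible e k x b']) ->
  visible e k x b.
Proof.
move=> b1 hb.
have /choice[q hq] : forall n : nat, exists q : R[i] * (R -> R[i]),
    [/\ normc q.1 <= 1, normc (q.1 - b) < n.+1%:R^-1 & lift e k x q.1 q.2].
  move=> n; have [|b' [b'1 b'b [sg hsg]]] := hb n.+1%:R^-1; first by rewrite invr_gt0.
  by exists (b', sg).
have [U [UU Uoo]] := free_ultrafilter.
have /choice[sg hsg] : forall t : R, exists l, 0 <= t <= 1 -> normc l <= 1 /\
    forall e1 : R, 0 < e1 -> U [set n | normc ((q n).2 t - l) < e1].
  move=> t; have [t1|t1] := boolP (0 <= t <= 1); last by exists 0.
  have [|l hl] := @ultra_disk_limit R U UU (fun n => (q n).2 t); last by exists l.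
  by move=> n; have [_ _ [_ _ /(_ t t1)[]]] := hq n.
have Ub (e1 : R) : 0 < e1 -> U [set n | normc ((q n).1 - b) < e1].
  move=> e10; have [N hN] := inv_succ_small e10.
  apply: filterS (Uoo N) => n /= /hN; apply: lt_trans.
  by have [_ ] := hq n.
have Ufb := ultra_continuous (UU := UU) fcont (fun n => let: And3 h _ _ := hq n in h) b1 Ub.
have i0 : (0 : R) <= (0 : R) <= (1 : R) by apply/andP; split; [exact: lexx|exact: ler01].
have i1 : (0 : R) <= (1 : R) <= (1 : R) by apply/andP; split; [exact: ler01|exact: lexx].
exists sg; split.
- apply: eq_normc_small => e1 e10; have [_ /(_ e1 e10)/filter_ex[n /=]] := hsg 0 i0.
  by have [_ _ [-> _ _ _]] := hq n; rewrite normcBC => /ltW.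
- apply: eq_normc_small => e1 e10; have e2 : 0 < e1 / 2 by lra.
  have [_ /(_ _ e2) U1] := hsg 1 i1.
  have [n /= []] := filter_ex (filterI U1 (Ub _ e2)).
  have [_ _ [_ -> _ _]] := hq n.
  have := normc_triangle (q n).1 (sg 1) b; rewrite (normcBC (sg 1) (q n).1); lra.
- move=> t t1; have [s1 Us] := hsg t t1; split => //.
  have qt1 n : normc ((q n).2 t) <= 1 by have [_ _ [_ _ /(_ t t1)[]]] := hq n.
  have Ufs := ultra_continuous (UU := UU) fcont qt1 s1 Us.
  apply: eq_normc_small => e1 e10; have e2 : 0 < e1 / 2 by lra.
  have [n /= []] := filter_ex (filterI (Ufs _ e2) (Ufb _ e2)).
  have [_ _ [_ _ /(_ t t1)[_ ->] _]] := hq n => h1 h2.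
  have := normc_triangle (f x + t%:C * (f (q n).1 - f x)) (f (sg t))
    (f x + t%:C * (f b - f x)).
  rewrite (normcBC (f (sg t)) (f x + t%:C * (f (q n).1 - f x))).
  have -> : f x + t%:C * (f (q n).1 - f x) - (f x + t%:C * (f b - f x)) =
    t%:C * (f (q n).1 - f b) by ring.
  case/andP: t1 => t0 t1.
  rewrite normcZ ger0_norm //.
  have := ler_wpM2r (normc_ge0 (f (q n).1 - f b)) t1; rewrite mul1r.
  lra.
- move=> t t' t1 t'1 tt'; apply/ler_addgt0Pl => e1 e10; have e2 : 0 < e1 / 2 by lra.
  have [_ /(_ _ e2) U1] := hsg t t1; have [_ /(_ _ e2) U2] := hsg t' t'1.
  have [n /= []] := filter_ex (filterI U1 U2).
  have [_ _ [_ _ _ /(_ t t' t1 t'1 tt')]] := hq n.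
  have := normc_triangle ((q n).2 t) (sg t) (sg t').
  have := normc_triangle ((q n).2 t') ((q n).2 t) (sg t').
  rewrite (normcBC (sg t) ((q n).2 t)); lra.
Qed.

End Lifts.

Section Rays.
Context {R : realType} (f : R[i] -> R[i]).
Implicit Types (x y z b p u : R[i]) (sg tau : R -> R[i]) (s t : R).
Context (d e k : R) (scale : lift_scale f d e k).
Hypotheses (fcont : disk_continuous f) (fopen : disk_open_map f).

(** Openness at the interior point [b] provides preimages close to [b] of the points slightly beyond
    [f b]; appended to the lift and reparametrized by the factor [r], they prolong it. *)
Lemma visible_extend x b : normc x < 1 -> normc b < 1 -> f b != f x ->
  visible f e k x b -> exists r b', [/\ 1 < r, normc b' <= 1,
    f b' = f x + r%:C * (f b - f x) & visible f e k x b'].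
Proof.
move=> x1 b1 bx [sg [sg0 sg1 sgf sgc]].
have [e0 ed k0 inj step] := scale.
set v := f b - f x.
have v0 : 0 < normc v by rewrite normc_gt0 subr_eq0.
have [dd dd0 hdd] := fopen b1 e0.
(* The first term gives [r <= 2], so the speed at most doubles; the second keeps the prolongation
   within [dd] of [f b]. *)
pose r := 1 + Num.min 1 (dd / (2 * normc v)).
have q0 : 0 < dd / (2 * normc v) by rewrite divr_gt0 // mulr_gt0.
have r1 : 1 < r by rewrite /r ltrDl lt_min ltr01.
have r2 : r <= 2 by rewrite /r -[2]/(1 + 1) lerD2l ge_min lexx.
have rv : (r - 1) * normc v < dd.
  have h : r - 1 <= dd / (2 * normc v) by rewrite /r addrAC subrr add0r ge_min lexx orbT.
  apply: le_lt_trans (ler_wpM2r (ltW v0) h) _.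
  rewrite invfM mulrA mulfVK ?gt_eqF //; lra.
have /choice[y hy] t : exists y, 1 < t * r <= r ->
    [/\ normc y < 1, normc (y - b) < e & f y = f x + (t * r)%:C * v].
  have [/andP[tr1 tr2]|_] := boolP (1 < t * r <= r); last by exists 0.
  have [|y hy] := hdd (f x + (t * r)%:C * v); last by exists y.
  have -> : f x + (t * r)%:C * v - f b = (t * r - 1)%:C * v by rewrite /v; ring.
  rewrite normcZ ger0_norm; last lra.
  apply: le_lt_trans rv; rewrite ler_wpM2r ?(ltW v0) //; lra.
pose tau t := if t * r <= 1 then sg (t * r) else y t.
have tauf t : 0 <= t <= 1 -> normc (tau t) <= 1 /\ f (tau t) = f x + (t * r)%:C * v.
  move=> /andP[t0 t1]; have tr0 : 0 <= t * r by rewrite mulr_ge0 //; lra.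
  rewrite /tau; case: (leP (t * r) 1) => tr1; first by apply: sgf; rewrite tr0.
  have [|/ltW y1 _ fy] := hy t; last by [].
  by rewrite tr1 ler_piMl //; lra.
have i1 : (0 : R) <= (1 : R) <= (1 : R) by apply/andP; split; [exact: ler01|exact: lexx].
have [b'1 fb'] := tauf 1 i1; rewrite mul1r in fb'.
have half (a a' : R) : 0 <= a <= 1 -> 0 <= a' <= 1 -> `|a - a'| <= 2 * k ->
    normc (sg a - sg a') <= 2 * e.
  move=> a1 a'1 aa'; have m1 : 0 <= (a + a') / 2 <= 1 by lra.
  have h1 : normc (sg a - sg ((a + a') / 2)) <= e.
    apply: sgc => //; have -> : a - (a + a') / 2 = (a - a') / 2 by field.
    rewrite normrM [X in _ * X]ger0_norm; lra.
  have h2 : normc (sg ((a + a') / 2) - sg a') <= e.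
    apply: sgc => //; have -> : (a + a') / 2 - a' = (a - a') / 2 by field.
    rewrite normrM [X in _ * X]ger0_norm; lra.
  have := normc_triangle (sg ((a + a') / 2)) (sg a) (sg a'); lra.
(* Jumps need only be bounded by [d] here, with at most [3 * e] in each case; the last clause of
   [lift_scale] then improves the bound to [e]. *)
have close t t' : 0 <= t -> t <= t' -> t' <= 1 -> t' - t <= k ->
    normc (tau t - tau t') <= d.
  move=> t0 tt' t'1 ktt'.
  have tr0 : 0 <= t * r by rewrite mulr_ge0 //; lra.
  have ttr : t * r <= t' * r by rewrite ler_wpM2r //; lra.
  have trk : t' * r - t * r <= 2 * k.
    by rewrite -mulrBl mulrC ler_pM // ?subr_ge0 //; lra.
  have tr' : t' * r <= r by rewrite ler_piMl //; lra.
  have yb (s : R) : 1 < s * r -> s * r <= r -> normc (y s - b) < e.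
    by move=> h1 h2; have [] := hy s; rewrite ?h1.
  rewrite /tau; case: (leP (t * r) 1) => tr1; case: (leP (t' * r) 1) => tr1'.
  - apply: le_trans (half _ _ _ _ _) _; [lra|lra| |lra].
    by rewrite distrC ger0_norm ?subr_ge0.
  - have h1 : normc (sg (t * r) - b) <= 2 * e.
      rewrite -sg1; apply: half => //; first lra.
      by rewrite distrC ger0_norm; lra.
    have := normc_triangle b (sg (t * r)) (y t'); have := yb t' tr1' tr'.
    rewrite (normcBC (y t') b); lra.
  - lra.
  - have := normc_triangle b (y t) (y t'); have := yb t' tr1' tr'.
    have := yb t tr1 (le_trans ttr tr').
    rewrite (normcBC (y t') b); lra.
exists r, (tau 1); split => //; exists tau; split => //.
- by rewrite /tau mul0r ler01.
- move=> t t1; have [? ->] := tauf t t1; split => //.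
  by rewrite fb'; ring.
- move=> t t' t1 t'1 tt'; have [n1 f1] := tauf t t1; have [n2 f2] := tauf t' t'1.
  apply: (step _ _ (tau 1) x) => //; first exact: ltW.
    have := ler_norm (t - t'); have := ler_norm (t' - t); rewrite (distrC t').
    have [h|h] := leP t t' => h1 h2; first by apply: close; lra.
    by rewrite normcBC; apply: close; lra.
  rewrite f1 f2 fb'.
  have -> : f x + (t * r)%:C * v - (f x + (t' * r)%:C * v) =
    (t - t')%:C * (f x + r%:C * v - f x) by ring.
  by rewrite normcZ ler_wpM2r // normc_ge0.
Qed.

(** Openness at [x] gives preimages within [e / 2] of [x], chosen independently for each parameter;
    any two of them are within [e], which is the jump bound of a lift. *)
Lemma visible_extend0 x u : normc x < 1 -> u != 0 -> exists r b',
  [/\ 0 < r, normc b' <= 1, f b' = f x + r%:C * u & visible f e k x b'].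
Proof.
move=> x1 u0; have [e0 _ k0 _ _] := scale.
have v0 : 0 < normc u by rewrite normc_gt0.
have e2 : 0 < e / 2 by lra.
have [dd dd0 hdd] := fopen x1 e2.
pose r := dd / (2 * normc u).
have r0 : 0 < r by rewrite divr_gt0 // mulr_gt0.
have rv : r * normc u < dd by rewrite /r invfM mulrA mulfVK ?gt_eqF //; lra.
have /choice[y hy] t : exists y, 0 <= t <= 1 ->
    [/\ normc y < 1, normc (y - x) < e / 2 & f y = f x + (t * r)%:C * u].
  have [/andP[t0 t1]|_] := boolP (0 <= t <= 1); last by exists 0.
  have [|y hy] := hdd (f x + (t * r)%:C * u); last by exists y.
  have tr0 : 0 <= t * r by rewrite mulr_ge0 // ltW.
  rewrite addrAC subrr add0r normcZ ger0_norm //.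
  by apply: le_lt_trans rv; rewrite ler_wpM2r ?(ltW v0) // ler_piMl // ltW.
pose tau t := if t == 0 then x else y t.
have tauf t : 0 <= t <= 1 ->
    [/\ normc (tau t) < 1, normc (tau t - x) < e / 2 & f (tau t) = f x + (t * r)%:C * u].
  rewrite /tau; case: eqP => [-> _|_ /hy//].
  by rewrite subrr normc0 !mul0r addr0.
have i1 : (0 : R) <= (1 : R) <= (1 : R) by apply/andP; split; [exact: ler01|exact: lexx].
have [b'1 _ fb'] := tauf 1 i1; rewrite mul1r in fb'.
exists r, (tau 1); split => //; first exact: ltW.
exists tau; split => //.
- by rewrite /tau eqxx.
- move=> t t1; have [/ltW ? _ ->] := tauf t t1; split => //.
  by rewrite fb'; ring.
- move=> t t' t1 t'1 tt'; have [_ n1 _] := tauf t t1; have [_ n2 _] := tauf t' t'1.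
  have := normc_triangle x (tau t) (tau t').
  rewrite (normcBC x (tau t')); lra.
Qed.

(** The lengths to which the ray lifts are bounded, as the image is. Their supremum [S] is attained
    because the visible points form a closed set, and the end reached there is on the circle, since
    a lift with interior end extends further. *)
Lemma visible_ray x u : normc x < 1 -> u != 0 -> exists s b,
  [/\ normc b = 1, 0 < s, f b = f x + s%:C * u & visible f e k x b].
Proof.
move=> x1 u0; have v0 : 0 < normc u by rewrite normc_gt0.
pose G : set R := [set s | 0 <= s /\ exists b,
  [/\ normc b <= 1, f b = f x + s%:C * u & visible f e k x b]].
have [r [b0 [r0 b01 fb0 vb0]]] := visible_extend0 x1 u0.
have Gr : G r by split; [exact: ltW|exists b0].
have [M M0 fM] := disk_image_bounded fcont.
have Gsup : has_sup G.
  split; first by exists r.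
  exists (M / normc u) => s [s0 [b [b1 fb _]]].
  have := fM b x b1 (ltW x1); rewrite fb addrAC subrr add0r normcZ ger0_norm //.
  by rewrite ler_pdivlMr.
set S := sup G.
have rS : r <= S by exact: sup_upper_bound.
have /choice[q hq] : forall n : nat, exists q : R * R[i],
    [/\ normc q.2 <= 1, f q.2 = f x + q.1%:C * u, visible f e k x q.2 &
      S - n.+1%:R^-1 < q.1 <= S].
  move=> n; have [|s Gs sS] := @sup_adherent _ G n.+1%:R^-1 _ Gsup.
    by rewrite invr_gt0.
  have [s0 [b [b1 fb vb]]] := Gs; exists (s, b); split => //=.
  by rewrite sS sup_upper_bound.
have q1 n : normc (q n).2 <= 1 by have [] := hq n.
have [U [UU Uoo]] := free_ultrafilter.
have [b [b1 Ub]] := @ultra_disk_limit R U UU _ q1.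
have Ufb := ultra_continuous (UU := UU) fcont q1 b1 Ub.
have vb : visible f e k x b.
  apply: (visible_closed fcont b1) => e1 e10.
  have [n /= nb] := filter_ex (Ub e1 e10).
  by exists (q n).2; have [] := hq n.
have fb : f b = f x + S%:C * u.
  apply: eq_normc_small => e1 e10; have e2 : 0 < e1 / 2 by lra.
  have [N hN] := inv_succ_small (divr_gt0 e2 v0).
  have [n /= [Nn nb]] := filter_ex (filterI (Uoo N) (Ufb _ e2)).
  have [_ fq _ qS] := hq n; have {}hN := hN n Nn.
  move: hN qS; move: (n.+1%:R^-1) => c hN qS.
  have := normc_triangle (f (q n).2) (f b) (f x + S%:C * u).
  rewrite (normcBC (f b) (f (q n).2)).
  have -> : f (q n).2 - (f x + S%:C * u) = ((q n).1 - S)%:C * u by rewrite fq; ring.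
  rewrite normcZ ler0_norm; last lra.
  have : (- ((q n).1 - S)) * normc u < e1 / 2 by rewrite -ltr_pdivlMr //; lra.
  lra.
have S0 : 0 < S by exact: lt_le_trans r0 rS.
exists S, b; split => //; apply/eqP; rewrite eq_le b1 /= leNgt; apply/negP => bi.
have fbx : f b != f x.
  rewrite fb -subr_eq0 addrAC subrr add0r mulf_neq0 //.
  by rewrite -normc_eq0 normc_real normr_eq0 gt_eqF.
have [r' [b' [r'1 b'1 fb' vb']]] := visible_extend x1 bi fbx vb.
have : G (r' * S).
  split; first by rewrite mulr_ge0 ?(ltW S0) //; lra.
  by exists b'; split => //; rewrite fb' fb; ring.
move=> /(sup_upper_bound Gsup); rewrite -/S; apply/negP; rewrite -ltNge.
by rewrite ltr_pMl.
Qed.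

End Rays.

(** * Openness at interior points *)

Section Cis.
Context {R : realType}.
Implicit Types (s t : R).

Lemma cisD s t : cis (s + t) = cis s * cis t.
Proof. by apply/eqP; rewrite eq_complex /= cosD sinD [X in _ && (_ == X)]addrC !eqxx. Qed.

Lemma cis0 : cis 0 = 1 :> R[i].
Proof. by rewrite /cis cos0 sin0. Qed.

Lemma cispi : cis pi = -1 :> R[i].
Proof. by apply/eqP; rewrite eq_complex /= cospi sinpi oppr0 !eqxx. Qed.

Lemma cisD2pi t : cis (t + 2 * pi) = cis t.
Proof. by rewrite mulrC mulr_natr /cis cosD2pi sinD2pi. Qed.

Lemma cis_continuous t (e : R) : 0 < e -> \forall t' \near t, normc (cis t' - cis t) < e.
Proof.
move=> e0; have e2 : 0 < e / 2 by lra.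
have hc : \forall t' \near t, `|cos t' - cos t| < e / 2.
  have /cvgrPdist_lt/(_ _ e2) := @continuous_cos R t.
  by apply: filterS => t'; rewrite distrC.
have hs : \forall t' \near t, `|sin t' - sin t| < e / 2.
  have /cvgrPdist_lt/(_ _ e2) := @continuous_sin R t.
  by apply: filterS => t'; rewrite distrC.
apply: filterS (filterI hc hs) => t' /= [].
have := normc_le_ReIm (cis t' - cis t); rewrite ReB ImB /=.
by move: `|_| `|_| => p q; lra.
Qed.

Lemma cis_continuous_dist t (e : R) : 0 < e -> exists2 d : R, 0 < d &
  forall t', `|t' - t| < d -> normc (cis t' - cis t) < e.
Proof.
move=> /(cis_continuous t)/nbhs_ballP[d d0 h]; exists d => // t' t't.
by apply: h; rewrite /ball /= distrC.
Qed.

(** In the right half plane the arctangent of the slope is an argument that varies continuously. *)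
Lemma polar_atan (w : R[i]) : 0 < complex.Re w ->
  w = (normc w)%:C * cis (atan (complex.Im w / complex.Re w)).
Proof.
case: w => a b /= a0.
set q := b / a; have bE : b = q * a by rewrite /q divfK // gt_eqF.
have n1 : 0 < 1 + q ^+ 2 by rewrite ltr_wpDr ?sqr_ge0.
have sE : sin (atan q) = q * cos (atan q).
  have := atanK q; rewrite /tan => qE; rewrite -[X in _ = X * _]qE divfK //.
  by rewrite cos_atan invr_eq0 sqrtr_eq0 -ltNge.
have nE : normc (a +i* b) = a * Num.sqrt (1 + q ^+ 2).
  rewrite /normc bE exprMn -[X in X + _]mul1r -mulrDl mulrC.
  by rewrite sqrtrM ?sqr_ge0 // sqrtr_sqr gtr0_norm.
have s0 : Num.sqrt (1 + q ^+ 2) != 0 by rewrite sqrtr_eq0 -ltNge.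
apply/eqP; rewrite eq_complex nE /= !mul0r subr0 addr0 sE cos_atan.
by rewrite mulfK // [q * _]mulrC mulrA mulfK // mulrC -bE !eqxx.
Qed.

End Cis.

(** * Winding numbers and openness *)

Section Openness.
Context {R : realType} (f : R[i] -> R[i]).
Hypothesis fcont : disk_continuous f.

(** Compactness. The annulus is used as a circle, with [lo = hi], and as a full disk, with
    [lo = 0]. *)
Lemma disk_annulus_dist x (lo hi : R) (p : R[i]) :
  (forall u, normc u <= 1 -> lo <= normc (u - x) <= hi -> f u <> p) ->
  exists2 a : R, 0 < a & forall u, normc u <= 1 -> lo <= normc (u - x) <= hi ->
    a <= normc (f u - p).
Proof.
move=> hp.
suff [a a0 h] : exists2 a : R, 0 < a & forall u v : R[i], normc u <= 1 -> normc v <= 1 ->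
    lo <= normc (u - x) <= hi -> a <= normc (f u - p).
  by exists a => // u u1; apply: (h u u).
apply: disk_pairs_compact => u v u1 _.
have [ux|ux] := boolP (lo <= normc (u - x) <= hi).
  have fup : 0 < normc (f u - p) / 2.
    by rewrite divr_gt0 // normc_gt0 subr_eq0; apply/eqP; exact: hp.
  have [dd dd0 hd] := fcont u1 fup.
  exists (Num.min dd (normc (f u - p) / 2)); first by rewrite lt_min dd0.
  move=> a u' v' /andP[a0]; rewrite !lt_min => /andP[_ aD] u'1 _ /andP[u'u _] _ _.
  have := hd _ u'1 u'u; have := normc_triangle (f u') (f u) p.
  rewrite (normcBC (f u) (f u')); lra.
have : normc (u - x) < lo \/ hi < normc (u - x).
  by move: ux; rewrite negb_and -!ltNge => /orP.
case=> h.
  exists (lo - normc (u - x)) => [|a u' v' _ _ _ u'u _ /andP[h1 h2]]; first lra.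
  have := normc_triangle u u' x; lra.
exists (normc (u - x) - hi) => [|a u' v' _ _ _ u'u _ /andP[h1 h2]]; first lra.
have := normc_triangle u' u x; rewrite (normcBC u u'); lra.
Qed.

Definition turns_once (a : R -> R[i]) := exists theta : R -> R,
  [/\ {within `[0, 2 * pi], continuous theta},
      forall t, 0 <= t <= 2 * pi -> a t = (normc (a t))%:C * cis (theta t) &
      theta (2 * pi) - theta 0 = 2 * pi].

Let loop_continuous (a : R -> R[i]) := forall (t e : R), 0 < e ->
  \forall t' \near t, normc (a t' - a t) < e.

(** The argument of Rouché: [b t] times the conjugate of [a t] lies in the right half plane, so an
    arctangent corrects [theta] into an argument of [b]. The correction has the same value at both
    ends. *)
Lemma turns_once_perturb (a b : R -> R[i]) :
  loop_continuous a -> loop_continuous b ->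
  a (2 * pi) = a 0 -> b (2 * pi) = b 0 ->
  (forall t, 0 <= t <= 2 * pi -> normc (b t - a t) < normc (a t)) ->
  turns_once a -> turns_once b.
Proof.
move=> ac bc aper bper ab [theta [thc thE th2pi]].
pose re t := complex.Re (b t) * complex.Re (a t) + complex.Im (b t) * complex.Im (a t).
pose im t := complex.Im (b t) * complex.Re (a t) - complex.Re (b t) * complex.Im (a t).
have wE t : b t * (a t)^* = re t +i* im t.
  rewrite /re /im; case: (a t) (b t) => a1 a2 [b1 b2].
  by apply/eqP; rewrite eq_complex /=; apply/andP; split; apply/eqP; ring.
have sq (z : R[i]) : normc z ^+ 2 = complex.Re z ^+ 2 + complex.Im z ^+ 2.
  by case: z => z1 z2; rewrite /normc sqr_sqrtr // addr_ge0 ?sqr_ge0.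
(* Squaring [normc (b t - a t) < normc (a t)] gives [normc (b t) ^+ 2 < 2 * re t]. *)
have re0 t : 0 <= t <= 2 * pi -> 0 < re t.
  move=> /ab; rewrite -(ltr_pXn2r (n := 2)) ?nnegrE ?normc_ge0 //.
  rewrite !sq ReB ImB /re.
  have := sqr_ge0 (complex.Re (b t)); have := sqr_ge0 (complex.Im (b t)).
  move: (complex.Re _) (complex.Im _) (complex.Re _) (complex.Im _) => b1 b2 a1 a2.
  nra.
exists (fun t => theta t + atan (im t / re t)); split.
- apply/subspace_continuousP => t tI.
  have t01 : 0 <= t <= 2 * pi by move: tI; rewrite /= in_itv.
  apply: cvgD; first by move/subspace_continuousP: thc; exact.
  have cR (g : R -> R[i]) : loop_continuous g ->
      (fun t' => complex.Re (g t')) @ within `[0, 2 * pi] (nbhs t) --> complex.Re (g t).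
    move=> gc; apply: cvg_within_filter; apply/cvgrPdist_lt => e e0.
    apply: filterS (gc t e e0) => t'; apply: le_lt_trans.
    by rewrite normcBC -ReB; exact: Re_le_normc.
  have cI (g : R -> R[i]) : loop_continuous g ->
      (fun t' => complex.Im (g t')) @ within `[0, 2 * pi] (nbhs t) --> complex.Im (g t).
    move=> gc; apply: cvg_within_filter; apply/cvgrPdist_lt => e e0.
    apply: filterS (gc t e e0) => t'; apply: le_lt_trans.
    by rewrite normcBC -ImB; exact: Im_le_normc.
  apply: (continuous_cvg _ (@continuous_atan R _)).
  apply: cvgM.
    by apply: cvgB; apply: cvgM; [exact: cI|exact: cR|exact: cR|exact: cI].
  apply: cvgV; first by rewrite gt_eqF // re0.
  by apply: cvgD; apply: cvgM; [exact: cR|exact: cR|exact: cI|exact: cI].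
- move=> t t01.
  have na : 0 < normc (a t).
    by apply: le_lt_trans (ab t t01); exact: normc_ge0.
  have nj : normc (a t)^* = normc (a t).
    by case: (a t) => a1 a2; rewrite /normc /= sqrrN.
  have naj : (a t)^* * a t = (normc (a t) ^+ 2)%:C.
    rewrite sq; case: (a t) => a1 a2.
    by apply/eqP; rewrite eq_complex /=; apply/andP; split; apply/eqP; ring.
  have wP : b t * (a t)^* = (normc (b t) * normc (a t))%:C * cis (atan (im t / re t)).
    have := polar_atan (w := re t +i* im t) (re0 t t01).
    by rewrite -{1 2}wE normcM nj.
  have nz : (normc (a t) ^+ 2)%:C != 0 :> R[i].
    by rewrite -normc_eq0 normc_real normr_eq0 expf_neq0 // gt_eqF.
  apply: (mulIf nz); rewrite -{1}naj mulrA wP cisD.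
  rewrite [X in _ * X = _](thE t t01) expr2 !rmorphM /=; ring.
- have -> : im (2 * pi) = im 0 by rewrite /im aper bper.
  have -> : re (2 * pi) = re 0 by rewrite /re aper bper.
  by rewrite opprD addrACA subrr addr0.
Qed.

(** By the intermediate value theorem [theta] takes the value [theta 0 + pi], where the polar form
    gives [c = - c]. *)
Lemma turns_once_not_cst (c : R[i]) : c != 0 -> ~ turns_once (fun=> c).
Proof.
move=> c0 [theta [thc thE th2pi]].
have p0 : 0 < pi :> R := pi_gt0 R.
have p2 : 0 <= 2 * pi :> R by lra.
have [|t /[!in_itv]/= t01 tE] := IVT (v := theta 0 + pi) p2 thc.
  rewrite ge_min le_max; apply/andP; split; apply/orP; [left|right]; lra.
have /(thE t) cE := t01; have c0E := thE 0; rewrite lexx p2 in c0E.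
move/eqP: c0; apply; have {}c0E := c0E isT.
rewrite tE cisD cispi mulrN1 mulrN -c0E in cE.
have /eqP : c + c = 0 by rewrite {2}cE subrr.
by rewrite -mulr2n mulrn_eq0 /= => /eqP.
Qed.

(** If a point [p] near [f x] had no preimage in the closed disk of radius [r] about [x], the image
    of its boundary circle, which turns once about [f x] and hence about [p], could be shrunk to a
    constant loop without meeting [p]. *)
Lemma disk_open_map_of_orientation :
  disk_locally_injective f -> orientation_preserving f -> disk_open_map f.
Proof.
move=> finj ori x x1 e e0.
have [dx dx0 hinj] := finj x (ltW x1).
pose r0 := Num.min (Num.min e dx) (1 - normc x).
have r00 : 0 < r0 by rewrite !lt_min e0 dx0 subr_gt0.
have /unit_diskP xD := x1.
have [r [[r1 rr0] [theta [thc thE thpi]]]] :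
    exists r, (0 < r /\ r < r0) /\ has_winding_number (fun t => f (x + r%:C * cis t)) (f x) 1.
  have := filter_ex (filterI (filterI (nbhs_right_gt 0) (nbhs_right_lt r00)) (ori x xD)).
  by move=> [r [[? ?] ?]]; exists r.
move: rr0; rewrite /r0 !lt_min => /andP[/andP[re rdx] r1x].
have disk u : normc (u - x) <= r -> normc u < 1.
  move=> ux; have := normc_triangle x u 0; rewrite !subr0; lra.
have [|m m0 hm] := @disk_annulus_dist x r r (f x).
  move=> u u1 /andP[ur1 ur2] fux.
  have ux : normc (u - x) < dx by lra.
  have := hinj u x u1 (ltW x1) ux; rewrite subrr normc0 => /(_ dx0 fux) uE.
  by move: ur1; rewrite uE subrr normc0; lra.
exists m => // p pm; apply: contrapT => nop.
have [|m2 m20 hm2] := @disk_annulus_dist x 0 r p.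
  move=> u u1 /andP[_ ur] fu; apply: nop; exists u; split => //; first exact: disk.
  by lra.
(* The image of the circle of radius [s * r] about [x], seen from [p]. *)
pose g s t := f (x + (s * r)%:C * cis t) - p.
have ptE s t : 0 <= s <= 1 -> normc (x + (s * r)%:C * cis t - x) = s * r.
  move=> /andP[s0 s1]; rewrite addrAC subrr add0r normcZ normc_cis mulr1 ger0_norm //.
  by rewrite mulr_ge0 // ltW.
have ptr s t : 0 <= s <= 1 -> normc (x + (s * r)%:C * cis t - x) <= r.
  by move=> s01; rewrite ptE // ler_piMl; lra.
have ptD s t : 0 <= s <= 1 -> normc (x + (s * r)%:C * cis t) <= 1.
  by move=> s01; apply/ltW/disk/ptr.
have gcont s : 0 <= s <= 1 -> loop_continuous (fun t => f (x + (s * r)%:C * cis t)).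
  move=> s01 t e1 e10; have [d d0 hd] := fcont (ptD s t s01) e10.
  apply: filterS (cis_continuous t d0) => t' t't; apply: hd; first exact: ptD.
  have -> : x + (s * r)%:C * cis t' - (x + (s * r)%:C * cis t) =
    (s * r)%:C * (cis t' - cis t) by ring.
  rewrite normcZ; apply: le_lt_trans t't; rewrite ler_piMl ?normc_ge0 //.
  have := ptE s t s01; rewrite addrAC subrr add0r normcZ normc_cis mulr1 => ->.
  have : s * r <= r by rewrite ler_piMl; lra.
  have := normc_ge0 x; lra.
have lcB (a : R -> R[i]) c : loop_continuous a -> loop_continuous (fun t => a t - c).
  move=> ac t e1 e10; apply: filterS (ac t e1 e10) => t' /=.
  by have -> : a t' - c - (a t - c) = a t' - a t by ring.
have gper s c : f (x + (s * r)%:C * cis (2 * pi)) - c = f (x + (s * r)%:C * cis 0) - c.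
  by rewrite -[2 * pi]add0r cisD2pi.
have i1 : (0 : R) <= (1 : R) <= (1 : R) by apply/andP; split; [exact: ler01|exact: lexx].
have W1 : turns_once (g 1).
  apply: (@turns_once_perturb (fun t => f (x + (1 * r)%:C * cis t) - f x)).
  - exact/lcB/gcont.
  - exact/lcB/gcont.
  - exact: gper.
  - exact: gper.
  - move=> t _; rewrite /g; set A := f _; have -> : A - p - (A - f x) = f x - p by ring.
    rewrite normcBC; apply: lt_le_trans pm _.
    by apply: hm; [exact: ptD|rewrite ptE // mul1r lexx].
  exists theta; split => //; last by rewrite thpi mulr1.
  move=> t t01; have /thE[_] : t \in `[0, 2 * pi] by rewrite in_itv.
  by rewrite normCE mul1r.
have [d d0 hd] := disk_uniformly_continuous fcont m20.
have [N hN] := inv_succ_small (divr_gt0 d0 r1).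
have {}hN := hN N (leqnn N).
(* The circle shrinks in [N.+1] equal steps, each moving the loop by less than [m2], a lower bound
   for its distance from [p]. *)
have Wn n : (n <= N.+1)%N -> turns_once (g (1 - n%:R / N.+1%:R)).
  elim: n => [|n IH] nN; first by rewrite mul0r subr0.
  have posn j : (j <= N.+1)%N -> (0 : R) <= 1 - j%:R / N.+1%:R <= (1 : R).
    move=> jN; rewrite gerBl divr_ge0 // andbT.
    by rewrite subr_ge0 ler_pdivrMr ?ltr0n // mul1r ler_nat.
  have sn := posn n (ltnW nN); have sn1 := posn n.+1 nN.
  apply: turns_once_perturb (IH (ltnW nN)).
  - exact/lcB/gcont.
  - exact/lcB/gcont.
  - exact: gper.
  - exact: gper.
  move=> t _; rewrite /g; set A := f _; set B := f _.
  have -> : A - p - (B - p) = A - B by ring.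
  apply: (@lt_le_trans _ _ m2).
    apply: hd; [exact: ptD|exact: ptD|].
    have -> : x + ((1 - n.+1%:R / N.+1%:R) * r)%:C * cis t -
      (x + ((1 - n%:R / N.+1%:R) * r)%:C * cis t) =
      (- (N.+1%:R^-1 * r))%:C * cis t.
      rewrite -[n.+1%:R]natr1 mulrDl; ring.
    rewrite normcZ normc_cis mulr1 normrN ger0_norm ?mulr_ge0 ?invr_ge0 ?(ltW r1) //.
    by rewrite -ltr_pdivlMr.
  apply: hm2; first exact: ptD.
  by rewrite normc_ge0 ptr.
have := Wn N.+1 (leqnn _); rewrite divff ?pnatr_eq0 // subrr /g.
have -> : (fun t => f (x + (0 * r)%:C * cis t) - p) = (fun=> f x - p).
  by apply/funext => t; rewrite !mul0r addr0.
apply: turns_once_not_cst; rewrite subr_eq0; apply/eqP => fxp.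
by apply: nop; exists x; rewrite subrr normc0.
Qed.

End Openness.

(** * The boundary polygon *)

Section Circle.
Context {R : realType}.
Implicit Types (s t u : R) (x y : R[i]).

Lemma cis_surj x : normc x = 1 -> exists2 t, 0 <= t < 2 * pi & x = cis t.
Proof.
case: x => a b; rewrite /normc => nx.
have p0 : 0 < pi :> R := pi_gt0 R.
have ab : a ^+ 2 + b ^+ 2 = 1.
  by rewrite -(sqr_sqrtr (addr_ge0 (sqr_ge0 a) (sqr_ge0 b))) nx expr1n.
have a1 : -1 <= a <= 1.
  by have := sqr_ge0 b => b0; apply/andP; split; nra.
have ca : cos (acos a) = a by apply: acosK; rewrite in_itv.
have sa : sin (acos a) = `|b|.
  by rewrite sin_acos // -ab addrAC subrr add0r sqrtr_sqr.
have ge0 := acos_ge0 a1; have lepi := acos_lepi a1.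
have [b0|b0] := leP 0 b.
  exists (acos a); first lra.
  by rewrite /cis ca sa ger0_norm.
have b20 : 0 < b ^+ 2 by rewrite exprn_even_gt0 //= lt_eqF.
have an : a < 1 by nra.
have gt0 : 0 < acos a by apply: acos_gt0; lra.
exists (- acos a + 2 * pi); first lra.
by rewrite cisD2pi /cis cosN sinN ca sa ltr0_norm // opprK.
Qed.

Lemma cis_surj_from s x : normc x = 1 -> exists2 t, s <= t < s + 2 * pi & x = cis t.
Proof.
move=> nx; have [|t t01 tE] := @cis_surj (x * cis (- s)).
  by rewrite normcM nx normc_cis mulr1.
exists (s + t); first lra.
by rewrite cisD -tE mulrC -mulrA -cisD addNr cis0 mulr1.
Qed.

Lemma cos_lt1 u : 0 < u < 2 * pi -> cos u < 1.
Proof.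
move=> u2; have s0 : 0 < sin (u / 2) by apply: sin_gt0_pi; lra.
have -> : u = (u / 2) *+ 2 by rewrite -mulr_natr divfK.
by rewrite cos_mulr2n cos2sin2; nra.
Qed.

Lemma cis_inj s t : `|s - t| < 2 * pi -> cis s = cis t -> s = t.
Proof.
move=> st [cE sE].
have c1 : cos (s - t) = 1.
  by rewrite cosB cE sE -!expr2 cos2Dsin2.
have [d0|d0|/eqP] := ltgtP (s - t) 0; last by rewrite subr_eq0 => /eqP.
  have := @cos_lt1 (- (s - t)); rewrite cosN c1 ltxx.
  by rewrite ltr0_norm // in st; rewrite st oppr_gt0 d0 => /(_ isT).
have := @cos_lt1 (s - t); rewrite c1 ltxx.
by rewrite gtr0_norm // in st; rewrite st d0 => /(_ isT).
Qed.

Lemma cos_gt_arc d u : 0 <= d <= pi -> `|u| < d -> cos d < cos u.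
Proof.
move=> d01 ud; rewrite -[cos u]cos_norm ltr_cos //; rewrite in_itv //=.
rewrite normr_ge0 /=; lra.
Qed.

Lemma cos_lt_arc d u : 0 <= d <= pi -> d < u < 2 * pi - d -> cos u < cos d.
Proof.
move=> d01 du; have [up|up] := leP u pi.
  by rewrite ltr_cos ?in_itv /=; lra.
have -> : cos u = cos (2 * pi - u).
  by rewrite -cosN -(cosD2pi (- u)) addrC mulrC mulr_natr.
by rewrite ltr_cos ?in_itv /=; lra.
Qed.

Lemma cis_continuousT : continuous (cis : R -> R[i]).
Proof. by move=> t; apply/cvg_normc => e e0; exact: cis_continuous. Qed.

End Circle.

Section Curve.
Context {R : realType} (g : R -> R[i]).
Hypothesis gcont : forall (t e : R), 0 < e ->
  exists2 d : R, 0 < d & forall t', `|t' - t| < d -> normc (g t' - g t) < e.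

(** The image of a compact segment under a continuous curve is closed. *)
Lemma segment_value_closed (a b : R) (p : R[i]) :
  (forall e : R, 0 < e -> exists2 t, a <= t <= b & normc (g t - p) < e) ->
  exists2 t, a <= t <= b & g t = p.
Proof.
move=> hp.
have /choice[q hq] : forall n : nat, exists t, a <= t <= b /\ normc (g t - p) < n.+1%:R^-1.
  by move=> n; have [|t] := hp n.+1%:R^-1; [rewrite invr_gt0|exists t].
have [U [UU Uoo]] := free_ultrafilter.
have [|t ht] := @ultra_real_limit R U UU q (`|a| + `|b|).
  move=> n; have [ab _] := hq n; rewrite ler_norml.
  have := ler_norm a; have := ler_norm b; have := ler_norm (- a); have := ler_norm (- b).
  by rewrite !normrN; move: (normr_ge0 a) (normr_ge0 b); move: `|a| `|b| => A B; lra.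
exists t.
  have key (e : R) : 0 < e -> a <= e + t /\ t <= e + b.
    move=> e0; have [n /= h] := filter_ex (ht e e0).
    have [/andP[ab1 ab2] _] := hq n; move: h; rewrite ltr_norml => /andP[h1 h2].
    by split; lra.
  by apply/andP; split; apply/ler_addgt0Pl => e /key[].
apply: eq_normc_small => e e0; have e2 : 0 < e / 2 by lra.
have [d d0 hd] := gcont t e2.
have [N hN] := inv_succ_small e2.
have [n /= [h Nn]] := filter_ex (filterI (ht d d0) (Uoo N)).
have [_ h2] := hq n; have h3 := hd _ h; have h4 := hN n Nn.
have {h4}h2 := lt_trans h2 h4.
have := normc_triangle (g (q n)) (g t) p.
rewrite (normcBC (g t) (g (q n))); lra.
Qed.

End Curve.

(** * Arcs between consecutive vertices *)

Section TurnSequence.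
Context {R : realType} (n : nat) (T : nat -> R).
Implicit Types (s t u : R) (x y : R[i]) (k l j : nat).
Hypotheses (Tlt : forall k, T k < T k.+1) (Tper : forall k, T (k + n)%N = T k + 2 * pi).

Lemma turn_ltn k l : (k < l)%N -> T k < T l.
Proof.
elim: l => // l IH; rewrite ltnS leq_eqVlt => /orP[/eqP->//|/IH h].
exact: lt_trans h (Tlt l).
Qed.

Lemma turn_leq k l : (k <= l)%N -> T k <= T l.
Proof. by rewrite leq_eqVlt => /orP[/eqP->//|/turn_ltn/ltW]. Qed.

Lemma turn_shift k j : T (k + j * n)%N = T k + 2 * pi * j%:R.
Proof.
elim: j => [|j IH]; first by rewrite mul0n addn0 mulr0 addr0.
by rewrite mulSnr addnA Tper IH -[j.+1%:R]natr1; ring.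
Qed.

Lemma cis_shift t j : cis (t + 2 * pi * j%:R) = cis t.
Proof.
elim: j => [|j IH]; first by rewrite mulr0 addr0.
by rewrite -[j.+1%:R]natr1 mulrDr mulr1 addrA cisD2pi.
Qed.

Lemma cis_turn_shift k j : cis (T (k + j * n)%N) = cis (T k).
Proof. by rewrite turn_shift cis_shift. Qed.

Lemma turn_gt0 : (0 < n)%N.
Proof.
rewrite lt0n; apply/eqP => n0; have := Tper 0; rewrite n0 addn0 => h.
have := pi_gt0 R; lra.
Qed.

Lemma circle_arc x : normc x = 1 -> exists k t, [/\ (k < n)%N, T k <= t < T k.+1 & x = cis t].
Proof.
move=> /(cis_surj_from (T 0))[t /andP[t0 tn] xE].
rewrite -Tper add0n in tn.
suff [k [kn kt]] : exists k, (k < n)%N /\ T k <= t < T k.+1 by exists k, t.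
elim: n tn => [|m IH] tm; first by move: t0; rewrite leNgt tm.
have [mt|/IH [k [km kt]]] := leP (T m) t; first by exists m; rewrite mt tm.
by exists k; split => //; exact: ltnW.
Qed.

Lemma arc_vertex_neq k l t : T k < t < T k.+1 -> cis t <> cis (T l).
Proof.
move=> /andP[kt tk] tE; have n0 := turn_gt0.
(* Adding [l] turns to [k] ensures [l <= K], so that [K - l] is a true difference; [L] is then the
   copy of [l] with [L <= K < L + n]. This brings the two arguments within less than one turn, where
   [cis] is injective. *)
pose K := (k + l * n)%N; pose L := (l + (K - l) %/ n * n)%N.
have lK : (l <= K)%N by rewrite /K (leq_trans _ (leq_addl _ _)) // leq_pmulr.
have LK : (L <= K)%N by rewrite /L -[leqRHS](subnKC lK) leq_add2l leq_divM.
have KL : (K < L + n)%N.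
  by rewrite /L -addnA -[ltnLHS](subnKC lK) ltn_add2l -mulSnr ltn_ceil.
pose u := t + 2 * pi * l%:R.
have uK : T K < u < T K.+1.
  by rewrite /K -addSn !turn_shift /u !ltrD2r kt tk.
have /(cis_inj _) : cis u = cis (T L) by rewrite /u cis_shift cis_turn_shift.
have h1 := turn_leq LK; have := turn_leq KL; rewrite Tper => h2.
have p0 := pi_gt0 R.
by rewrite ltr_norml => /(_ ltac:(lra)) uL; lra.
Qed.

Hypothesis n2 : (1 < n)%N.

Definition vertex_set : set R[i] := [set x | exists k, x = cis (T k)].

(** The line through the two end vertices separates the arc from the rest of the circle: the affine
    function [h] is positive on the arc and negative on the complementary open arc, so a connected
    set without vertices cannot meet both. *)
Lemma arc_component k t : T k < t < T k.+1 ->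
  connected_component (unit_circle `\` vertex_set) (cis t) = cis @` `]T k, T k.+1[.
Proof.
move=> kt; set S := unit_circle `\` vertex_set.
pose m := (T k + T k.+1) / 2; pose d := (T k.+1 - T k) / 2.
have p0 := pi_gt0 R.
have Tk := Tlt k.
have Tk2 : T k.+1 < T k + 2 * pi by rewrite -Tper turn_ltn // -addn1 ltn_add2l.
have d01 : 0 <= d <= pi by rewrite /d; lra.
pose h y := complex.Re (y * cis (- m)) - cos d.
have hE u : h (cis u) = cos (u - m) - cos d by rewrite /h -cisD.
have harc u : T k < u < T k.+1 -> 0 < h (cis u).
  move=> ku; rewrite hE subr_gt0; apply: cos_gt_arc => //.
  by rewrite ltr_norml /m /d; lra.
have hout u : T k.+1 < u < T k + 2 * pi -> h (cis u) < 0.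
  move=> ku; rewrite hE subr_lt0; apply: cos_lt_arc => //.
  by rewrite /m /d; lra.
have Scase y : S y -> (0 < h y /\ (cis @` `]T k, T k.+1[) y) \/ h y < 0.
  move=> [yc yv]; have y1 : normc y = 1 by exact/unit_circleP.
  have [u /andP[u1 u2] yE] := cis_surj_from (T k) y1.
  have [uk|uk] := ltP u (T k.+1).
    have ku : T k < u < T k.+1.
      rewrite uk andbT lt_neqAle u1 andbT; apply/eqP => ukE.
      by apply: yv; exists k; rewrite yE ukE.
    by left; rewrite yE; split; [exact: harc|exists u => //=; rewrite in_itv].
  right; rewrite yE; apply: hout; rewrite u2 andbT lt_neqAle uk andbT.
  by apply/eqP => ukE; apply: yv; exists k.+1; rewrite yE ukE.
have arcS : cis @` `]T k, T k.+1[ `<=` S.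
  move=> _ [u /= + <-]; rewrite in_itv /= => ku; split.
    exact/unit_circleP/normc_cis.
  by move=> [l]; exact: (@arc_vertex_neq k l u ku).
have arct : (cis @` `]T k, T k.+1[) (cis t) by exists t => //=; rewrite in_itv.
apply/seteqP; split; last first.
  apply: connected_component_max => //.
  apply: connected_continuous_connected.
    exact/connected_intervalP/interval_is_interval.
  exact/continuous_subspaceT/cis_continuousT.
move=> y Cy; have Sy := connected_component_sub Cy.
have [[]//|hy] := Scase y Sy; exfalso.
set C := connected_component S (cis t) in Cy.
have hcont : continuous h.
  move=> z A /nbhs_ballP[e /= e0 eA]; apply/nbhs_normc; exists e => // z' z'z.
  apply: eA; apply: le_lt_trans z'z; rewrite /ball_ /=.
  have -> : h z - h z' = complex.Re ((z - z') * cis (- m)).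
    by rewrite mulrBl ReB /h; ring.
  apply: le_trans (Re_le_normc _) _.
  by rewrite normcM normc_cis mulr1 normcBC.
have Ci : is_interval (h @` C).
  apply/connected_intervalP/connected_continuous_connected.
    exact: component_connected.
  exact: continuous_subspaceT.
have Ct : C (cis t).
  by apply: connected_component_refl; exact: arcS.
have [|z Cz hz] := Ci (h y) (h (cis t)) (ex_intro2 _ _ y Cy erefl)
    (ex_intro2 _ _ (cis t) Ct erefl) 0.
  by rewrite (ltW hy) (ltW (harc t kt)).
by have [[]|] := Scase z (connected_component_sub Cz); rewrite hz ltxx.
Qed.

End TurnSequence.

Section TurnsOfPolygon.
Context {R : realType}.

Lemma counterclockwise_turns (n : nat) (z : 'I_n -> R[i]) :
  (0 < n)%N -> counterclockwise z -> exists T : nat -> R,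
  [/\ forall k, T k < T k.+1, forall k, T (k + n)%N = T k + 2 * pi &
      range z = vertex_set T].
Proof.
case: n z => // m z _ [t [zE tlt tper]].
(* The remainder of [k] selects the vertex and the quotient counts full turns. *)
pose T k := t (inord (k %% m.+1)) + 2 * pi * (k %/ m.+1)%:R.
have Tqr q r : (r < m.+1)%N -> T (q * m.+1 + r)%N = t (inord r) + 2 * pi * q%:R.
  by move=> rm; rewrite /T modnMDl modn_small // divnMDl // divn_small // addn0.
exists T; split.
- move=> k; rewrite (divn_eq k m.+1).
  have rm := ltn_pmod k (ltn0Sn m); move: (k %% _)%N (k %/ _)%N rm => r q rm.
  rewrite Tqr //; have [rm'|rm'] := ltnP r.+1 m.+1.
    rewrite -addnS Tqr // ltrD2r; apply: tlt.
    by rewrite !inordK.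
  (* After the last vertex comes vertex [0] one turn later; the third clause of [counterclockwise]
     compares the two. *)
  have -> : r = m by apply/eqP; rewrite eqn_leq -ltnS rm -ltnS.
  rewrite -addnS -mulSnr -[(q.+1 * m.+1)%N]addn0 Tqr // -[q.+1%:R]natr1.
  have := tper (inord 0) (inord m); lra.
- move=> k; rewrite (divn_eq k m.+1).
  have rm := ltn_pmod k (ltn0Sn m); move: (k %% _)%N (k %/ _)%N rm => r q rm.
  by rewrite addnAC -mulSnr !Tqr // -[q.+1%:R]natr1; ring.
apply/seteqP; split => [x [j _ <-]|x [k ->]].
  exists (j : nat); rewrite zE -[in RHS](add0n (j : nat)) -(mul0n m.+1) Tqr //.
  by rewrite mulr0 addr0 inord_val.
exists (inord (k %% m.+1)) => //.
by rewrite zE /T cis_shift.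
Qed.

End TurnsOfPolygon.

Section Polygon.
Context {R : realType}.
Implicit Types (g : R -> R[i]) (T : nat -> R) (s t r : R) (k : nat) (a b p : R[i]).

Definition curve_continuous g := forall (t e : R), 0 < e ->
  exists2 d : R, 0 < d & forall t', `|t' - t| < d -> normc (g t' - g t) < e.

Definition curve_locally_injective g := forall t, exists2 d : R, 0 < d &
  forall t' t'', `|t' - t| < d -> `|t'' - t| < d -> g t' = g t'' -> t' = t''.

(* [T] lists the arguments of the vertices, continued periodically, so that
   edge [k] joins [g (T k)] to [g (T k.+1)] without reduction modulo [n]. *)
Record polygon (n : nat) g T : Prop := Polygon {
  turn_lt : forall k, T k < T k.+1;
  turn_per : forall k, T (k + n)%N = T k + 2 * pi;
  edge_neq : forall k, g (T k) <> g (T k.+1);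
  edge_param : forall k t, T k < t < T k.+1 -> exists r, 0 < r < 1 /\
    g t = g (T k) + r%:C * (g (T k.+1) - g (T k));
  edge_surj : forall k r, 0 < r < 1 -> exists t, T k < t < T k.+1 /\
    g t = g (T k) + r%:C * (g (T k.+1) - g (T k));
  edge_inj : forall k t t', T k < t < T k.+1 -> T k < t' < T k.+1 ->
    g t = g t' -> t = t' }.

(** As a limit of values of [g], the end [a] is itself a value on the closed interval; parameters
    strictly inside only give points of the open segment. *)
Lemma segment_endpoint g (lo hi : R) a b : curve_continuous g -> a <> b ->
  (forall r, 0 < r < 1 -> exists t, lo < t < hi /\ g t = a + r%:C * (b - a)) ->
  (forall t, lo < t < hi -> exists r, 0 < r < 1 /\ g t = a + r%:C * (b - a)) ->
  a = g lo \/ a = g hi.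
Proof.
move=> gc ab surj param.
have L0 : 0 < normc (b - a) by rewrite normc_gt0 subr_eq0 eq_sym; apply/eqP.
have [e e0|t /andP[lt th] gt] := @segment_value_closed _ g gc lo hi a.
  pose r := Num.min (1 / 2) (e / (2 * normc (b - a))).
  have q0 : 0 < e / (2 * normc (b - a)) by rewrite divr_gt0 // mulr_gt0.
  have r0 : 0 < r by rewrite /r lt_min q0 andbT; lra.
  have r2 : r <= 1 / 2 by rewrite /r ge_min lexx.
  have [|t [/andP[lt th] gt]] := surj r; first lra.
  exists t; first by rewrite !ltW.
  rewrite gt addrAC subrr add0r normcZ gtr0_norm //.
  have rq : r <= e / (2 * normc (b - a)) by rewrite /r ge_min lexx orbT.
  apply: le_lt_trans (ler_wpM2r (ltW L0) rq) _.
  rewrite invfM mulrA mulfVK ?gt_eqF //; lra.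
have [lo_t|lo_t] := eqVneq t lo; first by left; rewrite -gt lo_t.
have [hi_t|hi_t] := eqVneq t hi; first by right; rewrite -gt hi_t.
have [|r [/andP[r0 _]]] := param t; first by rewrite !lt_neqAle lt th eq_sym lo_t hi_t.
rewrite gt -[LHS]addr0 => /addrI/esym/eqP; rewrite mulf_eq0 subr_eq0.
by rewrite -normc_eq0 normc_real normr_eq0 gt_eqF //= eq_sym => /eqP.
Qed.

Lemma polygon_of_n_sided n (phi : R[i] -> R[i]) g : (1 < n)%N ->
  (forall t, phi (cis t) = g t) -> curve_continuous g -> n_sided n phi ->
  exists T, polygon n g T.
Proof.
move=> n1 phig gc [z [_ zc comps]].
have [T [Tlt Tper zT]] := counterclockwise_turns (ltnW n1) zc.
rewrite zT in comps; exists T.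
suff edge k : [/\ g (T k) <> g (T k.+1),
    forall t, T k < t < T k.+1 -> exists r, 0 < r < 1 /\
      g t = g (T k) + r%:C * (g (T k.+1) - g (T k)),
    forall r, 0 < r < 1 -> exists t, T k < t < T k.+1 /\
      g t = g (T k) + r%:C * (g (T k.+1) - g (T k)) &
    forall t t', T k < t < T k.+1 -> T k < t' < T k.+1 -> g t = g t' -> t = t'].
  by split => // k; have [] := edge k.
have Tk := Tlt k; have p0 := pi_gt0 R.
have Tk2 : T k.+1 < T k + 2 * pi by rewrite -Tper turn_ltn // -addn1 ltn_add2l.
pose m := (T k + T k.+1) / 2.
have mk : T k < m < T k.+1 by rewrite /m; lra.
have [|a [b [ab [[phifun phiinj phisurj] _ _]]]] := comps (cis m).
  split; first exact/unit_circleP/normc_cis.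
  by move=> [l]; exact: (@arc_vertex_neq _ n T Tlt Tper k l m mk).
rewrite (arc_component Tlt Tper n1 mk) in phifun phiinj phisurj.
have inarc t : T k < t < T k.+1 -> (cis @` `]T k, T k.+1[) (cis t).
  by move=> kt; exists t => //=; rewrite in_itv.
have inj t t' : T k < t < T k.+1 -> T k < t' < T k.+1 -> g t = g t' -> t = t'.
  move=> kt kt' gtt; apply: cis_inj; first by rewrite ltr_norml; lra.
  by apply: phiinj; rewrite ?inE ?phig //; exact: inarc.
have param t : T k < t < T k.+1 -> exists r, 0 < r < 1 /\ g t = a + r%:C * (b - a).
  move=> /inarc/phifun[r /= + rE]; rewrite in_itv /= => r01.
  by exists r; rewrite rE phig.
have surj r : 0 < r < 1 -> exists t, T k < t < T k.+1 /\ g t = a + r%:C * (b - a).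
  move=> r01; have [|_ [t /= + <-] gt] := phisurj (a + r%:C * (b - a)).
    by exists r => //=; rewrite in_itv.
  by rewrite in_itv /= => kt; exists t; rewrite -phig.
have aP : a = g (T k) \/ a = g (T k.+1).
  by apply: (@segment_endpoint g _ _ a b _ _ surj param) => //; apply/eqP.
have rev (r : R) : a + r%:C * (b - a) = b + (1 - r)%:C * (a - b) by ring.
have bP : b = g (T k) \/ b = g (T k.+1).
  apply: (@segment_endpoint g _ _ b a) => //.
  - by apply/eqP; rewrite eq_sym.
  - move=> r r01; have [|t [kt gt]] := surj (1 - r); first lra.
    by exists t; split => //; rewrite gt rev; congr (_ + _%:C * _); ring.
  - move=> t /param[r [r01 gt]]; exists (1 - r); split; first lra.
    by rewrite gt rev.
(* The edge may be traversed from [b] to [a], in which case [r] becomes [1 - r]. *)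
case: aP bP => aE [] bE; try by move: ab; rewrite aE bE eqxx.
  rewrite -aE -bE; split => //; exact/eqP.
rewrite -aE -bE; split => //.
- by apply/eqP; rewrite eq_sym.
- move=> t /param[r [r01 gt]]; exists (1 - r); split; first lra.
  by rewrite gt rev.
- move=> r r01; have [|t [kt gt]] := surj (1 - r); first lra.
  by exists t; split => //; rewrite gt rev; congr (_ + _%:C * _); ring.
Qed.

Lemma curve_far g (lo hi : R) p : curve_continuous g ->
  (forall t, lo <= t <= hi -> g t <> p) ->
  exists2 e : R, 0 < e & forall t, lo <= t <= hi -> e <= normc (g t - p).
Proof.
move=> gc gp; apply: contrapT => nfar.
have [e e0|t lht gt] := @segment_value_closed _ g gc lo hi p; last exact: gp gt.
apply: contrapT => nt; apply: nfar; exists e => // t lht.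
by rewrite leNgt; apply/negP => te; apply: nt; exists t.
Qed.

Lemma real_complex_neq0 (r : R) : 0 < r -> r%:C != 0 :> R[i].
Proof. by move=> r0; rewrite -normc_eq0 normc_real normr_eq0 gt_eqF. Qed.

Section Vertices.
Context (n : nat) g T (gT : polygon n g T).
Hypotheses (gc : curve_continuous g) (gi : curve_locally_injective g).

Lemma vertex_start_neq k t : T k < t < T k.+1 -> g t <> g (T k).
Proof.
move=> /(edge_param gT)[r [/andP[r0 r1] ->]].
rewrite -[RHS]addr0 => /addrI/eqP; rewrite mulf_eq0 subr_eq0.
rewrite (negbTE (real_complex_neq0 r0)) /= => /eqP/esym; exact: edge_neq gT _.
Qed.

Lemma vertex_end_neq k t : T k < t < T k.+1 -> g t <> g (T k.+1).
Proof.
move=> /(edge_param gT)[r [/andP[r0 r1] ->]].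
have -> : g (T k) + r%:C * (g (T k.+1) - g (T k)) =
  g (T k.+1) + (1 - r)%:C * (g (T k) - g (T k.+1)) by ring.
rewrite -[RHS]addr0 => /addrI/eqP; rewrite mulf_eq0 subr_eq0.
have r1' : 0 < 1 - r by lra.
rewrite (negbTE (real_complex_neq0 r1')) /= => /eqP; exact: edge_neq gT _.
Qed.

(* Near a vertex with interior angle [0] or [2 pi] the two edges would overlap,
   against local injectivity. *)
Lemma no_spike k (c : R) : 0 < c ->
  g (T k.+2) - g (T k.+1) <> c%:C * (g (T k) - g (T k.+1)).
Proof.
move=> c0 spike; have [d d0 hd] := gi (T k.+1).
have lt1 := turn_lt gT k; have lt2 := turn_lt gT k.+1.
have [|e1 e10 far1] := @curve_far g (T k) (T k.+1 - d) (g (T k.+1)) gc.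
  move=> t /andP[kt td]; have [->|tk] := eqVneq t (T k); first exact: edge_neq gT _.
  apply: vertex_end_neq; rewrite lt_neqAle eq_sym tk kt /=; lra.
have [|e2 e20 far2] := @curve_far g (T k.+1 + d) (T k.+2) (g (T k.+1)) gc.
  move=> t /andP[td kt]; have [->|tk] := eqVneq t (T k.+2).
    exact/nesym/(edge_neq gT).
  by apply: vertex_start_neq; apply/andP; split; [lra|rewrite lt_neqAle tk kt].
pose L := normc (g (T k) - g (T k.+1)).
have L0 : 0 < L by rewrite normc_gt0 subr_eq0; apply/eqP/(edge_neq gT).
(* The two edges share the point at fraction [r] of the first one, counted from the spike: [r < 1]
   and [r < c] place it on both edges, and the other two terms force both of its parameters within
   [d] of the vertex. *)
pose r := Num.min (Num.min 1 c) (Num.min (e1 / L) (e2 / L)) / 2.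
have m0 : 0 < Num.min (Num.min 1 c) (Num.min (e1 / L) (e2 / L)).
  by rewrite !lt_min ltr01 c0 !divr_gt0.
have r0 : 0 < r by rewrite /r; lra.
have : r < Num.min (Num.min 1 c) (Num.min (e1 / L) (e2 / L)) by rewrite /r; lra.
rewrite !lt_min !ltr_pdivlMr // => /andP[/andP[r1 rc] /andP[rL1 rL2]].
have [|t [kt gt]] := edge_surj gT k (r := 1 - r); first lra.
have [|t' [kt' gt']] := edge_surj gT k.+1 (r := r / c).
  by rewrite divr_gt0 // ltr_pdivrMr // mul1r rc.
have gtE : g t - g (T k.+1) = r%:C * (g (T k) - g (T k.+1)) by rewrite gt; ring.
have gtE' : g t' - g (T k.+1) = r%:C * (g (T k) - g (T k.+1)).
  rewrite gt' spike addrAC subrr add0r mulrA -rmorphM /= divfK // gt_eqF //.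
have td : T k.+1 - d < t.
  rewrite ltNge; apply/negP => td; have : e1 <= normc (g t - g (T k.+1)).
    apply: far1; rewrite td andbT; lra.
  by rewrite gtE normcZ gtr0_norm // leNgt rL1.
have td' : t' < T k.+1 + d.
  rewrite ltNge; apply/negP => td'; have : e2 <= normc (g t' - g (T k.+1)).
    apply: far2; rewrite td' /=; lra.
  by rewrite gtE' normcZ gtr0_norm // leNgt rL2.
have : t = t'.
  apply: hd; [by rewrite ltr_norml; lra|by rewrite ltr_norml; lra|].
  by apply: (addIr (- g (T k.+1))); rewrite gtE gtE'.
by move=> tt'; lra.
Qed.

End Vertices.
End Polygon.

(** * Injectivity on the open disk *)

Section Cross.
Context {R : realType}.
Implicit Types (x y z u v p q : R[i]) (r s t : R).

(** The determinant of two plane vectors; its sign tells on which side of the line spanned by [x]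
    the vector [y] lies. *)
Definition cross x y : R := complex.Re x * complex.Im y - complex.Im x * complex.Re y.

Lemma crossxx x : cross x x = 0.
Proof. by rewrite /cross mulrC subrr. Qed.

Lemma cross0r x : cross x 0 = 0.
Proof. by rewrite /cross /= !mulr0 subrr. Qed.

Lemma crossC x y : cross x y = - cross y x.
Proof. by case: x y => [a b] [c d]; rewrite /cross /=; ring. Qed.

Lemma crossDr u x y : cross u (x + y) = cross u x + cross u y.
Proof. by case: u x y => [a b] [c d] [e f]; rewrite /cross /=; ring. Qed.

Lemma crossBr u x y : cross u (x - y) = cross u x - cross u y.
Proof. by case: u x y => [a b] [c d] [e f]; rewrite /cross /=; ring. Qed.

Lemma crossZr u r x : cross u (r%:C * x) = r * cross u x.
Proof. by case: u x => [a b] [c d]; rewrite /cross /=; ring. Qed.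

Lemma cross_parallel x y z : z != 0 -> cross x z = 0 -> cross y z = 0 -> cross x y = 0.
Proof.
move=> z0 xz yz; apply/eqP.
have : (cross x y)%:C * z = (cross x z)%:C * y - (cross y z)%:C * x.
  case: x y z {z0 xz yz} => [a b] [c d] [e f]; rewrite /cross.
  by apply/eqP; rewrite eq_complex /=; apply/andP; split; apply/eqP; ring.
rewrite xz yz !mul0r subr0 => /eqP; rewrite mulf_eq0 (negbTE z0) orbF.
by move=> /eqP/complexI/eqP.
Qed.

(** Each [P j] excludes at most one parameter; if it lies in the current interval, only the part to
    its right is kept. *)
Lemma avoid_points (m : nat) (P : nat -> R -> Prop) (a b : R) :
  (forall j t t', (j < m)%N -> P j t -> P j t' -> t = t') -> a < b ->
  exists a' b', [/\ a <= a', a' < b', b' <= b &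
    forall t j, a' < t < b' -> (j < m)%N -> ~ P j t].
Proof.
move=> uniqP ab; elim: m uniqP => [|m IH] uniqP.
  by exists a, b; split.
have [|a' [b' [aa' ab' bb' avoid]]] := IH.
  by move=> j t t' jm; apply: uniqP; exact: leqW.
have [[c [/andP[ac cb] Pc]]|nP] := pselect (exists c, a' < c < b' /\ P m c).
  exists c, b'; split => //; first exact: le_trans aa' (ltW ac).
  move=> t j /andP[ct tb]; rewrite ltnS leq_eqVlt => /orP[/eqP->|jm].
    by move=> /(uniqP m _ _ (ltnSn m) Pc) cE; move: ct; rewrite cE ltxx.
  by apply: avoid => //; rewrite tb (lt_trans ac ct).
exists a', b'; split => // t j tab; rewrite ltnS leq_eqVlt => /orP[/eqP->|jm].
  by move=> Pt; apply: nP; exists t.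
exact: avoid.
Qed.

(** First a direction [1 +i* s] parallel to no [v j] is chosen, then a short displacement along it,
    which meets each line through [p j] with direction [v j] at most once. *)
Lemma generic_point (m : nat) (p v : nat -> R[i]) q (d : R) : 0 < d ->
  (forall j, (j < m)%N -> v j != 0) -> exists q', normc (q' - q) < d /\
    forall j, (j < m)%N -> cross (v j) (q' - p j) != 0.
Proof.
move=> d0 v0.
have [|a' [b' [a0 ab b1 hs]]] := @avoid_points m
    (fun j s => cross (v j) (1 +i* s) = 0) 0 1 _ ltr01.
  move=> j s s' jm; have := v0 j jm; rewrite eq_complex negb_and /cross /=.
  case: (v j) => a b /=; have [-> /=|an _ h1 h2] := eqVneq a 0.
    by rewrite !mul0r mulr1 sub0r => /negbTE b0 /eqP; rewrite oppr_eq0 b0.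
  by apply: (mulfI an); lra.
pose s := (a' + b') / 2.
have hs' j : (j < m)%N -> cross (v j) (1 +i* s) != 0.
  by move=> jm; apply/eqP; apply: hs => //; rewrite /s; lra.
have [| |a'' [b'' [a0' ab' b1' ht]]] := @avoid_points m
    (fun j t => cross (v j) (q + t%:C * (1 +i* s) - p j) = 0) 0 (d / 2).
- move=> j t t' jm; rewrite !crossBr !crossDr !crossZr => h1 h2.
  apply: (mulIf (hs' j jm)); lra.
- lra.
pose t := (a'' + b'') / 2.
exists (q + t%:C * (1 +i* s)); split; last first.
  by move=> j jm; apply/eqP; apply: ht => //; rewrite /t; lra.
have t0 : 0 < t by rewrite /t; lra.
have td : t < d / 2 by rewrite /t; lra.
have s01 : 0 < s < 1 by rewrite /s; lra.
rewrite addrAC subrr add0r normcZ gtr0_norm //.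
have := normc_le_ReIm (1 +i* s); rewrite /= normr1 ger0_norm; last lra.
move=> n1; have n2 : normc (1 +i* s) <= 2 by lra.
by apply: le_lt_trans (ler_wpM2l (ltW t0) n2) _; lra.
Qed.

Lemma convex_lt (a b c r : R) : 0 <= r <= 1 -> a < c -> b < c ->
  (1 - r) * a + r * b < c.
Proof.
move=> /andP[r0 r1] ac bc; have [->|rn0] := eqVneq r 0.
  by rewrite subr0 mul1r mul0r addr0.
have rb : r * b < r * c by rewrite ltr_pM2l // lt_neqAle eq_sym rn0.
have ra : (1 - r) * a <= (1 - r) * c by rewrite ler_wpM2l ?subr_ge0 // ltW.
by move: ra rb; rewrite !mulrBl !mul1r; lra.
Qed.

Lemma convex_zero_sign (a b r : R) : a != 0 -> b != 0 -> 0 < r < 1 ->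
  a + r * (b - a) = 0 -> (0 < a) = ~~ (0 < b).
Proof.
move=> a0 b0 r01 h; case: (ltgtP a 0) a0 => // ha _; case: (ltgtP b 0) b0 => // hb _ //=.
  by exfalso; nra.
by exfalso; nra.
Qed.

End Cross.

Section DiskInjective.
Context {R : realType} (n : nat) (f : R[i] -> R[i]) (T : nat -> R).
Let g t := f (cis t).
Hypotheses (n5 : (n <= 5)%N) (gT : polygon n g T).
Implicit Types (x y b u q : R[i]) (t r s : R).

Let Tlt := turn_lt gT.
Let Tper := turn_per gT.

Lemma vertex_mod k : g (T k) = g (T (k %% n)).
Proof.
by rewrite {1}(divn_eq k n) addnC /g (cis_turn_shift Tper).
Qed.

(* A closed polygon crosses a line an even number of times. *)
Lemma line_meets_le4 u q (bs : seq R[i]) :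
  (forall k, cross u (g (T k) - q) != 0) -> uniq bs ->
  (forall b, b \in bs -> normc b = 1 /\ cross u (f b - q) = 0) ->
  (size bs <= 4)%N.
Proof.
move=> uw ubs hbs; pose s k := cross u (g (T k) - q).
have sE k t r : g t = g (T k) + r%:C * (g (T k.+1) - g (T k)) ->
    cross u (g t - q) = s k + r * (s k.+1 - s k).
  by move=> ->; rewrite /s !crossBr crossDr crossZr crossBr; ring.
have /choice[K hK] : forall b, exists k, b \in bs ->
    (k < n)%N /\ exists2 t, T k < t < T k.+1 & b = cis t.
  move=> b; have [bb|_] := boolP (b \in bs); last by exists 0.
  have [b1 ub] := hbs b bb; have [k [t [kn /andP[kt tk] bE]]] := circle_arc Tper b1.
  exists k => _; split => //; exists t => //; rewrite tk andbT lt_neqAle kt andbT.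
  by apply/eqP => tE; move/eqP: (uw k); apply; rewrite -ub bE tE.
have hs b : b \in bs -> exists t r, [/\ T (K b) < t < T (K b).+1, b = cis t, 0 < r < 1,
    g t = g (T (K b)) + r%:C * (g (T (K b).+1) - g (T (K b))) &
    s (K b) + r * (s (K b).+1 - s (K b)) = 0].
  move=> bb; have [_ [t kt bE]] := hK b bb; have [_ ub] := hbs b bb.
  have [r [r01 gt]] := edge_param gT kt; exists t, r; split => //.
  by rewrite -(sE _ _ _ gt) /g -bE.
(* An edge with both ends off the line meets it at most once. *)
have Kinj : {in bs &, injective K}.
  move=> b b' bb bb' KE.
  have [t [r [kt bE r01 gt h]]] := hs b bb; have [t' [r' [kt' bE' _ gt' h']]] := hs b' bb'.
  rewrite bE bE'; congr cis; rewrite -KE in kt' gt' h'.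
  apply: (edge_inj gT kt kt'); rewrite gt gt'; congr (_ + _%:C * _).
  have s0 : s (K b).+1 - s (K b) != 0.
    apply/eqP => s0; move: h; rewrite s0 mulr0 addr0; apply/eqP; exact: uw.
  by apply: (mulIf s0); apply: (addrI (s (K b))); rewrite h h'.
have uK : uniq (map K bs) by rewrite map_inj_in_uniq.
have subK : {subset map K bs <= iota 0 n}.
  by move=> _ /mapP[b bb ->]; rewrite mem_iota; have [] := hK b bb.
(* Five points would occupy five edges, so [n = 5] and the sign of [s] would change along each edge:
   an odd number of changes around a closed polygon. *)
rewrite leqNgt; apply/negP => bs5.
have [sz eqK] := uniq_min_size uK subK
  ltac:(by rewrite size_iota size_map (leq_trans n5 bs5)).
have nE : n = 5%N.
  apply/eqP; rewrite eqn_leq n5 (leq_trans bs5) //.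
  by rewrite -(size_map K) sz size_iota.
have alt k : (k < 5)%N -> (0 < s k) = ~~ (0 < s k.+1).
  move=> k5; have : k \in map K bs by rewrite eqK nE mem_iota.
  move=> /mapP[b bb kE]; have [t [r [_ _ /andP[r0 r1] _]]] := hs b bb; rewrite -kE => h.
  by apply: (@convex_zero_sign _ _ _ r); rewrite ?uw // r0.
have : s 5%N = s 0%N by rewrite /s vertex_mod nE.
move=> s50; have := alt 0%N isT.
rewrite (alt 1%N isT) (alt 2%N isT) (alt 3%N isT) (alt 4%N isT) s50.
by case: (0 < s 0%N).
Qed.

Hypotheses (fcont : disk_continuous f) (finj : disk_locally_injective f)
  (fopen : disk_open_map f).

Lemma disk_injective x1 x2 : normc x1 < 1 -> normc x2 < 1 -> f x1 = f x2 -> x1 = x2.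
Proof.
move=> x11 x21 fx12; apply: contrapT => /eqP x12.
have r0 : 0 < normc (x1 - x2) / 2 by rewrite divr_gt0 // normc_gt0 subr_eq0.
have [d1 d10 h1] := fopen x11 r0; have [d2 d20 h2] := fopen x21 r0.
have d0 : 0 < Num.min d1 d2 by rewrite lt_min d10.
have v0 k : (k < n)%N -> g (T k.+1) - g (T k) != 0.
  by move=> _; rewrite subr_eq0; apply/eqP/nesym/(edge_neq gT).
(* The double value is moved to a point [q] off the lines of all edges; by openness it still has two
   preimages, near [x1] and near [x2]. *)
have [q [qx qoff]] := generic_point (fun k => g (T k)) (f x1) d0 v0.
move: qx; rewrite lt_min => /andP[qx1 qx2]; rewrite fx12 in qx2.
have [y1 [y11 yx1 fy1]] := h1 q qx1; have [y2 [y21 yx2 fy2]] := h2 q qx2.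
have y12 : y1 <> y2.
  move=> yE; rewrite -yE in yx2; have := normc_triangle y1 x1 x2.
  rewrite (normcBC x1 y1); lra.
have fy12 : f y1 = f y2 by rewrite fy1.
have [d d'0 hd] := lift_scale_exists fcont finj.
have [||k scale] := hd (d / 4); [lra|lra|].
set e := d / 4 in scale.
have qw j : (j < n)%N -> g (T j) - q != 0.
  move=> jn; apply: contra (qoff j jn); rewrite subr_eq0 => /eqP <-.
  by rewrite subrr cross0r.
(* Here the line through [q] and [g t] avoids all vertices. Were [cis t] visible from neither point,
   it would be a fifth boundary point over this line, besides the ends of the two opposite rays
   lifted from [y1] and from [y2]. *)
have good i t : (i < n)%N -> T i < t < T i.+1 ->
    (forall j, (j < n)%N -> cross (g t - q) (g (T j) - q) <> 0) ->
    visible f e k y1 (cis t) \/ visible f e k y2 (cis t).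
  move=> i_n it gen; apply: contrapT => /not_orP[nv1 nv2].
  set u := g t - q in gen *.
  have u0 : u != 0.
    apply/eqP => u0; have [r [_ gt]] := edge_param gT it.
    move/eqP: (qoff i i_n); apply.
    have -> : q - g (T i) = r%:C * (g (T i.+1) - g (T i)).
      by move/eqP: u0; rewrite subr_eq0 => /eqP <-; rewrite gt addrAC subrr add0r.
    by rewrite crossZr crossxx mulr0.
  have Nu0 : - u != 0 by rewrite oppr_eq0.
  have [s1 [b1 [b11 s10 fb1 v1]]] := visible_ray scale fcont fopen y11 u0.
  have [s2 [b2 [b21 s20 fb2 v2]]] := visible_ray scale fcont fopen y11 Nu0.
  have [s3 [b3 [b31 s30 fb3 v3]]] := visible_ray scale fcont fopen y21 u0.
  have [s4 [b4 [b41 s40 fb4 v4]]] := visible_ray scale fcont fopen y21 Nu0.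
  rewrite fy1 in fb1 fb2; rewrite fy2 in fb3 fb4.
  have opp (s s' : R) b b' : 0 < s -> 0 < s' -> f b = q + s%:C * u ->
      f b' = q + s'%:C * - u -> b != b'.
    move=> s0 s'0 fb fb'; apply/eqP => bE; move: fb; rewrite bE fb' => /addrI/eqP.
    rewrite mulrN eq_sym -subr_eq0 opprK -mulrDl -rmorphD /= mulf_eq0 (negbTE u0) orbF.
    by apply/negP; apply: real_complex_neq0; exact: addr_gt0.
  have dist b b' : visible f e k y1 b -> visible f e k y2 b' -> b != b'.
    move=> vb vb'; apply/eqP => bE; rewrite bE in vb.
    exact: y12 (visible_inj scale fy12 vb vb').
  have nb b : visible f e k y1 b \/ visible f e k y2 b -> cis t != b.
    by move=> vb; apply/eqP => bE; rewrite -bE in vb; case: vb.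
  have ubs : uniq [:: cis t; b1; b2; b3; b4].
    rewrite /= !inE !negb_or !andbT (opp _ _ _ _ s10 s20 fb1 fb2) (opp _ _ _ _ s30 s40 fb3 fb4).
    rewrite (dist _ _ v1 v3) (dist _ _ v1 v4) (dist _ _ v2 v3) (dist _ _ v2 v4).
    by rewrite !nb //; [right|right|left|left].
  suff : (size [:: cis t; b1; b2; b3; b4] <= 4)%N by [].
  apply: (@line_meets_le4 u q) => // [j|b].
    by rewrite vertex_mod; apply/eqP; apply: gen; rewrite ltn_mod (turn_gt0 Tper).
  rewrite !inE; have ul (s : R) : cross u (q + s%:C * u - q) = 0.
    by rewrite addrAC subrr add0r crossZr crossxx mulr0.
  have uN (s : R) : cross u (q + s%:C * - u - q) = 0.
    by rewrite -(ul (- s)) rmorphN /= mulrN mulNr.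
  case/or4P => [/eqP->|/eqP->|/eqP->|/orP[]/eqP->]; rewrite ?fb1 ?fb2 ?fb3 ?fb4 //.
  by rewrite normc_cis crossxx.
(* Parameters accepted by [good] accumulate at every boundary point from the right, and the visible
   sets are closed. *)
have all_visible b : normc b = 1 -> visible f e k y1 b \/ visible f e k y2 b.
  move=> b1; apply: contrapT => /not_orP[nv1 nv2].
  have far y : ~ visible f e k y b -> exists2 e1 : R, 0 < e1 & forall b',
      normc b' <= 1 -> normc (b' - b) < e1 -> ~ visible f e k y b'.
    move=> nv; apply: contrapT => nfar; apply: nv.
    apply: (visible_closed fcont) => [|e1 e10]; first by rewrite b1.
    apply: contrapT => nb; apply: nfar; exists e1 => // b' b'1 b'b vb'.
    by apply: nb; exists b'.
  have [e1 e10 far1] := far y1 nv1; have [e2 e20 far2] := far y2 nv2.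
  have [i [t0 [i_n /andP[it0 t0i] bE]]] := circle_arc Tper b1.
  have e12 : 0 < Num.min e1 e2 by rewrite lt_min e10.
  have [dd dd0 hdd] := cis_continuous_dist t0 e12.
  have [| |a' [b' [ta' ab' bT hav]]] := @avoid_points R n (fun j t =>
      T i < t < T i.+1 /\ cross (g t - q) (g (T j) - q) = 0) t0 (Num.min (T i.+1) (t0 + dd)).
  (* The line of edge [i] does not contain [q], so it meets the line through [q] and a vertex at
     most once. *)
  - move=> j t t' jn [it ct] [it' ct']; apply: (edge_inj gT it it').
    have [r [_ gt]] := edge_param gT it; have [r' [_ gt']] := edge_param gT it'.
    rewrite gt gt'; congr (_ + _%:C * _).
    set w := g (T j) - q in ct ct'; set v := g (T i.+1) - g (T i) in gt gt'.
    have cE (t1 r1 : R) : g t1 = g (T i) + r1%:C * v ->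
        cross (g t1 - q) w = cross (g (T i) - q) w + r1 * cross v w.
      move=> ->; rewrite crossC [cross (_ - _) w]crossC [cross v w]crossC.
      by rewrite addrAC crossDr crossZr; ring.
    have B0 : cross v w != 0.
      apply/eqP => B0; have A0 : cross (g (T i) - q) w = 0.
        by move: (cE t r gt); rewrite ct B0 mulr0 addr0.
      move/eqP: (qoff i i_n); apply.
      have -> : q - g (T i) = (-1)%:C * (g (T i) - q) by rewrite rmorphN1 mulN1r opprB.
      by rewrite crossZr (cross_parallel (qw j jn) B0 A0) mulr0.
    by apply: (mulIf B0); move: (cE _ _ gt) (cE _ _ gt'); rewrite ct ct'; lra.
  - by rewrite lt_min t0i ltrDl.
  pose t := (a' + b') / 2.
  move: bT; rewrite le_min => /andP[bT bd].
  have it : T i < t < T i.+1 by rewrite /t; lra.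
  have tdd : `|t - t0| < dd by rewrite ltr_norml /t; lra.
  have := hdd t tdd; rewrite -bE lt_min => /andP[c1 c2].
  have c1' : normc (cis t) <= 1 by rewrite normc_cis.
  have [|v|v] := good i t i_n it.
  - move=> j jn cj; apply: (hav t j) => //; rewrite /t; lra.
  - exact: far1 v.
  - exact: far2 v.
have open_nv y : open [set t | ~ visible f e k y (cis t)].
  rewrite openE => t nv; apply: contrapT => nint; apply: nv.
  apply: (visible_closed fcont) => [|e1 e10]; first by rewrite normc_cis.
  apply: contrapT => nb; apply: nint.
  apply: filterS (cis_continuous t e10) => t' t't /= vt'.
  by apply: nb; exists (cis t'); rewrite normc_cis.
have one0 : (1 : R[i]) != 0 := oner_neq0 _.
have [s1 [b1 [b11 _ _ vb1]]] := visible_ray scale fcont fopen y11 one0.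
have [s2 [b2 [b21 _ _ vb2]]] := visible_ray scale fcont fopen y21 one0.
have [t1 _ bE1] := cis_surj b11; have [t2 _ bE2] := cis_surj b21.
(* The parameters visible from [y1] form a closed set; it is also open, being the complement of
   those visible from [y2]. Hence it is all of [R]. *)
have connR : connected [set: R] by apply/connected_intervalP => x y _ _ z _.
have AT := connR [set t | visible f e k y1 (cis t)].
have : visible f e k y1 (cis t2).
  suff : [set t | visible f e k y1 (cis t)] t2 by [].
  rewrite AT //; first by exists t1; rewrite /= -bE1.
    exists [set t | ~ visible f e k y2 (cis t)]; first exact: open_nv.
    rewrite setTI; apply/seteqP; split => t /= vt.
      by move=> vt2; exact: y12 (visible_inj scale fy12 vt vt2).
    by have [] := all_visible (cis t) (normc_cis t).
  exists [set t | visible f e k y1 (cis t)]; last by rewrite setTI.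
  rewrite -[X in closed X]setCK; apply: open_closedC; exact: open_nv.
rewrite -bE2 => vb12; exact: y12 (visible_inj scale fy12 vb12 vb2).
Qed.

End DiskInjective.

(** * Injectivity on the circle *)

Section CoveredSide.
Context {R : realType} (n : nat) (f : R[i] -> R[i]) (T : nat -> R).
Let g t := f (cis t).
Hypotheses (n5 : (n <= 5)%N) (gT : polygon n g T).
Hypotheses (fcont : disk_continuous f) (finj : disk_locally_injective f)
  (fopen : disk_open_map f).
Implicit Types (x y b u v w p q : R[i]) (t r s : R) (i k : nat).

Let Tlt := turn_lt gT.
Let Tper := turn_per gT.

Lemma circle_inward x (e : R) : normc x = 1 -> 0 < e ->
  exists y, [/\ normc y < 1, 1 - e < normc y & normc (y - x) < e].
Proof.
move=> x1 e0; pose s := Num.min e 1 / 2.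
have m0 : 0 < Num.min e 1 by rewrite lt_min e0 ltr01.
have s0 : 0 < s by rewrite /s; lra.
have : s < Num.min e 1 by rewrite /s; lra.
rewrite lt_min => /andP[se s1].
exists ((1 - s)%:C * x); rewrite normcZ x1 mulr1 ger0_norm; last lra.
have -> : (1 - s)%:C * x - x = (- s)%:C * x by ring.
rewrite normcZ normrN gtr0_norm // x1 mulr1; split => //; lra.
Qed.

(** Interior points near [x] have images near [f y], which are also taken within [e] of [y]. The
    choice of [e] keeps this neighborhood away from the points of norm above [1 - e], against
    injectivity on the open disk. *)
Lemma disk_circle_disjoint x y : normc x = 1 -> normc y < 1 -> f x <> f y.
Proof.
move=> x1 y1 fxy; pose e := (1 - normc y) / 2.
have e0 : 0 < e by rewrite /e; lra.
have [d d0 hd] := fopen y1 e0.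
have x1' : normc x <= 1 by rewrite x1.
have [d' d'0 hd'] := fcont x1' d0.
have ed0 : 0 < Num.min e d' by rewrite lt_min e0.
have [z [z1 zx]] := circle_inward x1 ed0; rewrite lt_min => /andP[ze zd].
have zx' : 1 - e < normc z.
  apply: le_lt_trans zx; rewrite lerD2l lerN2 ge_min lexx //.
have fz := hd' z (ltW z1) zd; rewrite fxy in fz.
have [y' [y'1 y'y fy']] := hd (f z) fz.
have := disk_injective n5 gT fcont finj fopen y'1 z1 fy' => y'z.
have := normc_triangle y y' 0; rewrite !subr0.
by move: zx'; rewrite -y'z /e in y'y *; lra.
Qed.

Lemma edge_circle k r : 0 < r < 1 ->
  exists b, normc b = 1 /\ f b = g (T k) + r%:C * (g (T k.+1) - g (T k)).
Proof.
move=> /(edge_surj gT k)[t [_ gt]]; exists (cis t); split => //; exact: normc_cis.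
Qed.

(** For [r = 1] the point [q] is the end vertex and the half edge is the whole edge; dually for
    [r = 0] in the next lemma. *)
Lemma half_edge_start k r s : 0 < r <= 1 -> 0 < s < 1 ->
  let q := g (T k) + r%:C * (g (T k.+1) - g (T k)) in
  exists b, normc b = 1 /\ f b = q + s%:C * (g (T k) - q).
Proof.
move=> r01 s01 q; have [|b [b1 fb]] := edge_circle k (r := (1 - s) * r).
  by apply/andP; split; nra.
by exists b; split => //; rewrite fb /q; ring.
Qed.

Lemma half_edge_end k r s : 0 <= r < 1 -> 0 < s < 1 ->
  let q := g (T k) + r%:C * (g (T k.+1) - g (T k)) in
  exists b, normc b = 1 /\ f b = q + s%:C * (g (T k.+1) - q).
Proof.
move=> r01 s01 q; have [|b [b1 fb]] := edge_circle k (r := r + s * (1 - r)).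
  by apply/andP; split; nra.
by exists b; split => //; rewrite fb /q; ring.
Qed.

(** With [sg] equal to [1] or [-1], the points [p] fill an open half disk on one side of the line
    through [q] directed by [v]. *)
Definition covers_side q v (sg rho : R) := forall p, normc (p - q) < rho ->
  0 < sg * cross v (p - q) -> exists y, normc y < 1 /\ f y = p.

(** The complementary closed arc is at positive distance from [cis t], so nearby points of the
    circle belong to the same edge. *)
Lemma near_edge_on_line k t : T k < t < T k.+1 -> exists2 r, 0 < r &
  forall b, normc b = 1 -> normc (b - cis t) < r ->
    cross (g (T k.+1) - g (T k)) (f b - g t) = 0.
Proof.
move=> kt; have [rt [_ gt]] := edge_param gT kt.
have Tk := Tlt k.
have [|r r0 far] := @curve_far _ cis (T k.+1) (T k + 2 * pi) (cis t) (@cis_continuous_dist R).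
  move=> u ku /(cis_inj _) uE; have : u = t by apply: uE; rewrite ltr_norml; lra.
  move=> ut; lra.
exists r => // b b1 bt; have [u /andP[ku uk] bE] := cis_surj_from (T k) b1.
have uk1 : u < T k.+1.
  rewrite ltNge; apply/negP => h; have := far u; rewrite h (ltW uk) => /(_ isT).
  by rewrite leNgt -bE bt.
rewrite bE -/(g u) gt; have [->|uTk] := eqVneq u (T k).
  have -> : forall w v, w - (w + rt%:C * v) = (- rt)%:C * v by move=> w v; ring.
  by rewrite crossZr crossxx mulr0.
have [|ru [_ ->]] := edge_param gT (k := k) (t := u).
  by rewrite lt_neqAle eq_sym uTk ku.
have -> : forall w v, w + ru%:C * v - (w + rt%:C * v) = (ru - rt)%:C * v by move=> w v; ring.
by rewrite crossZr crossxx mulr0.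
Qed.

(* The image of the half disk around [cis t] is open in the complement of the
   line of the edge and, by lifting segments, closed on one side of it. *)
Lemma edge_covers_side k t : T k < t < T k.+1 -> exists sg rho : R,
  [/\ sg = 1 \/ sg = -1, 0 < rho &
    covers_side (g t) (g (T k.+1) - g (T k)) sg rho].
Proof.
move=> kt; set v := g (T k.+1) - g (T k); set x := cis t.
have v0 : v != 0 by rewrite subr_eq0; apply/eqP/nesym/(edge_neq gT).
have [r0 r00 online] := near_edge_on_line kt.
have [d d0 hd] := lift_scale_exists fcont finj.
pose e := Num.min (d / 4) (r0 / 2).
have e0 : 0 < e by rewrite lt_min; apply/andP; split; lra.
have ed : 4 * e <= d.
  have : e <= d / 4 by rewrite /e ge_min lexx.
  lra.
have er0 : e < r0.
  have : e <= r0 / 2 by rewrite /e ge_min lexx orbT.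
  lra.
have [K scale] := hd e e0 ed; have [_ _ K0 _ step] := scale.
have x1 : normc x = 1 := normc_cis t.
have xle : normc x <= 1 by rewrite x1.
(* The last clause of [lift_scale], applied to the ends of the edge, turns this radius into the
   bound [e] of [close]. *)
pose rho := K * normc (f (cis (T k.+1)) - f (cis (T k))).
have rho0 : 0 < rho by rewrite mulr_gt0 // normc_gt0.
have close y : normc y <= 1 -> normc (y - x) <= d -> normc (f y - g t) <= rho ->
    normc (y - x) <= e.
  by move=> y1 yx fy; apply: (step y x (cis (T k.+1)) (cis (T k))); rewrite ?normc_cis.
(* A starting point near [x] whose image is off the line of the edge; the side of this image fixes
   [sg]. *)
have [u0 [u01 u0x fu0 cu0]] : exists u0, [/\ normc u0 < 1, normc (u0 - x) <= e,
    normc (f u0 - g t) < rho & cross v (f u0 - g t) != 0].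
  have rho2 : 0 < rho / 2 by lra.
  have [d' d'0 hd'] := fcont xle rho2.
  have m0 : 0 < Num.min d' (e / 2) by rewrite lt_min d'0; lra.
  have [z [z1 _]] := circle_inward x1 m0; rewrite lt_min => /andP[zd ze].
  have fz := hd' z (ltW z1) zd.
  have e2 : 0 < e / 2 by lra.
  have [d'' d''0 hd''] := fopen z1 e2.
  have m0' : 0 < Num.min d'' (rho / 2) by rewrite lt_min d''0.
  have [p [pz pc]] := @generic_point R 1 (fun=> g t) (fun=> v) (f z) _ m0' (fun _ _ => v0).
  move: pz; rewrite lt_min => /andP[pz1 pz2].
  have [u [u1 uz fu]] := hd'' p pz1.
  exists u; split => //.
  - have := normc_triangle z u x; lra.
  - rewrite fu; have := normc_triangle (f z) p (g t); move: fz; rewrite -/(g t); lra.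
  - by rewrite fu; exact: (pc 0%N).
pose sg : R := if 0 < cross v (f u0 - g t) then 1 else -1.
have sgP : sg = 1 \/ sg = -1 by rewrite /sg; case: ifP => _; [left|right].
have su0 : 0 < sg * cross v (f u0 - g t).
  rewrite /sg; case: (ltP 0 (cross v (f u0 - g t))) => h; first by rewrite mul1r.
  by rewrite mulN1r oppr_gt0 lt_neqAle cu0.
exists sg, rho; split => // p pq cp.
have [<-|pu0] := eqVneq (f u0) p; first by exists u0.
have u_neq0 : p - f u0 != 0 by rewrite subr_eq0 eq_sym.
have [s [b [b1 s0 fb [tau [tau0 tau1 tauf tauc]]]]] :=
  visible_ray scale fcont fopen u01 u_neq0.
have tau_val r : 0 <= r <= 1 -> f (tau r) = f u0 + (r * s)%:C * (p - f u0).
  by move=> /tauf[_ ->]; rewrite fb; ring.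
(* The half disk is convex, and [r * s <= 1] means that the ray from [f u0] has not gone beyond
   [p]. *)
have side r : 0 <= r <= 1 -> r * s <= 1 ->
    normc (f (tau r) - g t) < rho /\ 0 < sg * cross v (f (tau r) - g t).
  move=> r01 rs1; rewrite tau_val //.
  have rs0 : 0 <= r * s by apply: mulr_ge0; lra.
  have -> : f u0 + (r * s)%:C * (p - f u0) - g t =
    (1 - r * s)%:C * (f u0 - g t) + (r * s)%:C * (p - g t) by ring.
  split.
    apply: le_lt_trans (le_normcD _ _) _; rewrite !normcZ !ger0_norm; [|lra|lra].
    by apply: convex_lt; rewrite ?rs0.
  rewrite crossDr !crossZr.
  have -> : forall A B c : R, sg * ((1 - c) * A + c * B) =
    - ((1 - c) * - (sg * A) + c * - (sg * B)) by move=> A B c; ring.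
  by rewrite oppr_gt0; apply: convex_lt; rewrite ?oppr_lt0 ?rs0.
(* A parameter step of at most [K] takes the lift at most [2 * e <= d] away from [x]; its image
   being in the half disk, [close] brings the bound back to [e]. *)
have stay m : forall r, 0 <= r <= 1 -> r * s <= 1 -> r <= m%:R * K -> normc (tau r - x) <= e.
  elim: m => [|m IH] r r01 rs1.
    rewrite mul0r => r_le0; have -> : r = 0 by lra.
    by rewrite tau0.
  rewrite -[m.+1%:R]natr1 mulrDl mul1r => rm.
  have [r' [r'01 r's1 r'm rr']] : exists r', [/\ 0 <= r' <= 1, r' * s <= 1,
      r' <= m%:R * K & `|r - r'| <= K].
    have mK : 0 <= m%:R * K by rewrite mulr_ge0 // ltW.
    have [rK|Kr] := leP r K.
      by exists 0; rewrite mul0r subr0 ger0_norm; [split; lra|lra].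
    exists (r - K); have -> : r - (r - K) = K by ring.
    rewrite ger0_norm ?(ltW K0) //; split; [lra| |lra|exact: lexx].
    by rewrite mulrBl; have := mulr_gt0 K0 s0; lra.
  have h1 := IH r' r'01 r's1 r'm; have h2 := tauc r r' r01 r'01 rr'.
  have [taur1 _] := tauf r r01.
  apply: close => //; last by have [/ltW] := side r r01 rs1.
  have := normc_triangle (tau r') (tau r) x; lra.
(* A circle point within [e] of [x] is mapped to the line of the edge, whereas the lifted ray is
   still strictly on one side. *)
have inside r : 0 <= r <= 1 -> r * s <= 1 -> normc (tau r) < 1.
  move=> r01 rs1; have [taur1 _] := tauf r r01.
  rewrite lt_neqAle taur1 andbT; apply/eqP => taur.
  have [M hM] : exists M : nat, r / K < M%:R.
    by exists (Num.bound (r / K)); apply: archi_boundP; rewrite divr_ge0; lra.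
  have rM : r <= M%:R * K by rewrite -ler_pdivrMr // ltW.
  have := online _ taur (le_lt_trans (stay M r r01 rs1 rM) er0).
  by have [_] := side r r01 rs1; rewrite -/v => /lt0r_neq0 + h; rewrite h mulr0 eqxx.
have i1 : (0 : R) <= (1 : R) <= (1 : R) by apply/andP; split; [exact: ler01|exact: lexx].
(* The ray reaches [p] at parameter [s^-1]; if [s < 1], it would end on the circle before [p]. *)
have [s1|s1] := leP 1 s.
  have r01 : 0 <= s^-1 <= 1 by rewrite invr_ge0 (ltW s0) invf_le1.
  have rs1 : s^-1 * s = 1 by rewrite mulVf // gt_eqF.
  exists (tau s^-1); split; first by apply: inside; rewrite ?rs1.
  by rewrite tau_val // rs1 mul1r addrC subrK.
have : normc (tau 1) < 1 by apply: inside; rewrite ?mul1r ?(ltW s1).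
by rewrite tau1 b1 ltxx.
Qed.

End CoveredSide.

(** * Exclusion of double points of the boundary *)

Section BoundaryInjective.
Context {R : realType} (n : nat) (f : R[i] -> R[i]) (T : nat -> R).
Let g t := f (cis t).
Hypotheses (n5 : (n <= 5)%N) (n3 : (3 <= n)%N) (gT : polygon n g T).
Hypotheses (gc : curve_continuous g) (gi : curve_locally_injective g).
Hypotheses (fcont : disk_continuous f) (finj : disk_locally_injective f)
  (fopen : disk_open_map f).
Implicit Types (x y b u v w p q : R[i]) (t r s : R) (i k : nat).

Let Tlt := turn_lt gT.
Let Tper := turn_per gT.

(* Otherwise the half edge would enter the image of the open disk. *)
Lemma covers_side_half_edge q v sg rho w : covers_side f q v sg rho -> 0 < rho ->
  (forall s, 0 < s < 1 -> exists b, normc b = 1 /\ f b = q + s%:C * (w - q)) ->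
  sg * cross v (w - q) <= 0.
Proof.
move=> cov rho0 half; rewrite leNgt; apply/negP => cw.
have L0 : 0 < normc (w - q) + 1 by have := normc_ge0 (w - q); lra.
pose s := Num.min (1 / 2) (rho / (2 * (normc (w - q) + 1))).
have q0 : 0 < rho / (2 * (normc (w - q) + 1)) by rewrite divr_gt0 // mulr_gt0.
have s0 : 0 < s by rewrite lt_min q0 andbT; lra.
have s2 : s <= 1 / 2 by rewrite ge_min lexx.
have sq : s <= rho / (2 * (normc (w - q) + 1)) by rewrite ge_min lexx orbT.
have [|b [b1 fb]] := half s; first lra.
have [| |y [y1 fy]] := cov (f b).
- rewrite fb addrAC subrr add0r normcZ gtr0_norm //.
  have : s * (normc (w - q) + 1) <= rho / 2.
    by rewrite -ler_pdivlMr // -mulrA -invfM.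
  rewrite mulrDr mulr1; lra.
- rewrite fb addrAC subrr add0r crossZr mulrCA mulr_gt0 //.
by apply: (disk_circle_disjoint n5 gT fcont finj fopen b1 y1); rewrite fy.
Qed.

Lemma vertex_shift k i : exists2 m, (m < n)%N & g (T k) = g (T (i + m)).
Proof.
have n0 : (0 < n)%N by exact: leq_trans n3.
have iK : (i <= k + i * n)%N by rewrite (leq_trans _ (leq_addl _ _)) // leq_pmulr.
exists ((k + i * n - i) %% n)%N; first by rewrite ltn_mod.
have -> : g (T k) = g (T (k + i * n)) by rewrite /g (cis_turn_shift Tper).
rewrite -[in LHS](subnKC iK) {1}(divn_eq (k + i * n - i) n).
by rewrite [(_ * n + _)%N]addnC addnA /g (cis_turn_shift Tper).
Qed.

Lemma vertex_per k : g (T (k + n)) = g (T k).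
Proof. by rewrite /g Tper cisD2pi. Qed.

(** As [n <= 5], two vertices are at most two edges apart in one direction. Coinciding neighbors
    contradict [edge_neq]; at two edges, the vertex between them would be a spike. *)
Lemma vertices_inj i d : (0 < d < n)%N -> g (T i) <> g (T (i + d)).
Proof.
move=> /andP[d0 dn] gid.
have [d1|d1] := eqVneq d 1%N.
  by case: (edge_neq gT (k := i)); rewrite gid d1 addn1.
have [dn1|dn1] := eqVneq d.+1 n.
  by case: (edge_neq gT (k := (i + d)%N)); rewrite -addnS dn1 vertex_per gid.
have [d2|d2] := eqVneq d 2%N.
  apply: (@no_spike _ _ _ _ gT gc gi i 1) => //.
  by rewrite mul1r gid d2 addn2.
have dn2 : d.+2 = n by lia.
apply: (@no_spike _ _ _ _ gT gc gi (i + d) 1) => //.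
by rewrite mul1r -!addnS dn2 vertex_per gid.
Qed.

(** A ray perpendicular to the line, lifted from a point on the wrong side, would end at a boundary
    point even farther on that side, although each edge is on the right side with its two ends. *)
Lemma supporting_line q v sg : sg = 1 \/ sg = -1 -> v != 0 ->
  (forall k, sg * cross v (g (T k) - q) <= 0) ->
  forall y, normc y < 1 -> sg * cross v (f y - q) <= 0.
Proof.
move=> sgP v0 vert y y1; rewrite leNgt; apply/negP => cy.
(* [v] turned by a right angle towards the side selected by [sg]. *)
pose u := sg%:C * ((- complex.Im v) +i* complex.Re v).
have cu : 0 < sg * cross v u.
  rewrite /u crossZr mulrA; have -> : sg * sg = 1 by case: sgP => ->; ring.
  rewrite mul1r /cross /=; move: v0; case: (v) => a b; rewrite eq_complex /= negb_and.
  have := sqr_ge0 a; have := sqr_ge0 b; rewrite mulrN opprK -!expr2 => b0 a0.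
  by case/orP => h; [rewrite ltr_wpDr // exprn_even_gt0|rewrite ltr_wpDl // exprn_even_gt0].
have u0 : u != 0.
  apply/eqP => uE; move: cu; rewrite uE cross0r mulr0 ltxx //.
have [d d0 hd] := lift_scale_exists fcont finj.
have [||K scale] := hd (d / 4); [lra|lra|].
have [s [b [b1 s0 fb _]]] := visible_ray scale fcont fopen y1 u0.
have [k [t [_ /andP[kt tk] bE]]] := circle_arc Tper b1.
have : sg * cross v (f b - q) <= 0.
  rewrite bE -/(g t); have [->//|tTk] := eqVneq t (T k).
  have [|r [r01 ->]] := edge_param gT (k := k) (t := t).
    by rewrite lt_neqAle eq_sym tTk kt.
  have -> : g (T k) + r%:C * (g (T k.+1) - g (T k)) - q =
    (1 - r)%:C * (g (T k) - q) + r%:C * (g (T k.+1) - q) by ring.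
  rewrite crossDr !crossZr mulrDr !(mulrCA sg).
  by move: (vert k) (vert k.+1); move: (sg * _) (sg * _) => A B; nra.
have -> : f b - q = (f y - q) + s%:C * u by rewrite fb; ring.
rewrite crossDr crossZr mulrDr (mulrCA sg).
by have := mulr_gt0 s0 cu; lra.
Qed.

(** The ends of the edge are excluded directly and their other neighbors by spikes. There remains
    the vertex opposite an edge of a pentagon, where the covered half disk contradicts
    [supporting_line]. *)
Lemma edge_vertex_neq i d t : (d < n)%N -> T i < t < T i.+1 -> g t <> g (T (i + d)).
Proof.
move=> dn it gtd.
have [r [r01 gt]] := edge_param gT it.
have r0 : r != 0 by rewrite gt_eqF //; lra.
have [d0|d0] := eqVneq d 0%N.
  by case: (vertex_start_neq gT it); rewrite gtd d0 addn0.
have [d1|d1] := eqVneq d 1%N.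
  by case: (vertex_end_neq gT it); rewrite gtd d1 addn1.
have [d2|d2] := eqVneq d 2%N.
  apply: (@no_spike _ _ _ _ gT gc gi i (1 - r)); first lra.
  by rewrite -addn2 -d2 -gtd gt; ring.
have [dn1|dn1] := eqVneq d.+1 n.
  apply: (@no_spike _ _ _ _ gT gc gi (i + d) r^-1); first by rewrite invr_gt0; lra.
  rewrite -!addnS dn1 [(i + n.+1)%N]addnS -addSn !vertex_per -gtd gt.
  by rewrite addrAC subrr add0r mulrA -rmorphM /= mulVf // mul1r.
have [dE nE] : d = 3%N /\ n = 5%N by lia.
set v := g (T i.+1) - g (T i) in gt.
have v0 : v != 0 by rewrite subr_eq0; apply/eqP/nesym/(edge_neq gT).
have [sg [rho [sgP rho0 cov]]] := edge_covers_side gT fcont finj fopen it; rewrite -/v in cov.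
(* Vertices [i] and [i + 1] are on the line and [i + 3] is at [g t]; the edges from there to [i + 2]
   and [i + 4] cannot enter the covered half disk. *)
have vert k : sg * cross v (g (T k) - g t) <= 0.
  have [m mn ->] := vertex_shift k i; rewrite nE in mn.
  have on0 : cross v (g (T i) - g t) = 0.
    have -> : g (T i) - g t = (- r)%:C * v by rewrite gt; ring.
    by rewrite crossZr crossxx mulr0.
  have on1 : cross v (g (T i.+1) - g t) = 0.
    have -> : g (T i.+1) - g t = (1 - r)%:C * v by rewrite gt /v; ring.
    by rewrite crossZr crossxx mulr0.
  case: m mn => [|[|[|[|[|//]]]]] _.
  - by rewrite addn0 on0 mulr0.
  - by rewrite addn1 on1 mulr0.
  - apply: (covers_side_half_edge cov rho0) => s s01.
    have [||b [b1 fb]] := half_edge_start gT (i + 2) (r := 1) (s := s); [lra|by []|].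
    exists b; split => //; rewrite fb.
    have -> : g (T (i + 2)) + 1%:C * (g (T (i + 2).+1) - g (T (i + 2))) = g t.
      by rewrite rmorph1 mul1r addrC subrK gtd dE -addnS.
    by [].
  - by rewrite -dE -gtd subrr cross0r mulr0.
  - apply: (covers_side_half_edge cov rho0) => s s01.
    have [||b [b1 fb]] := half_edge_end gT (i + 3) (r := 0) (s := s); [lra|by []|].
    exists b; split => //; rewrite fb.
    have -> : g (T (i + 3)) + 0%:C * (g (T (i + 3).+1) - g (T (i + 3))) = g t.
      by rewrite rmorph0 mul0r addr0 gtd dE.
    by have -> : (i + 4 = (i + 3).+1)%N by rewrite addnS.
have := supporting_line sgP v0 vert.
have x1 : normc (cis t) = 1 := normc_cis t.
have xle : normc (cis t) <= 1 by rewrite x1.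
have [d' d'0 hd'] := fcont xle rho0.
have [z [z1 _ zd]] := circle_inward x1 d'0.
have fz := hd' z (ltW z1) zd.
have m0 : 0 < rho - normc (f z - f (cis t)) by lra.
have [p [pz pc]] := @generic_point R 1 (fun=> g t) (fun=> v) (f z) _ m0 (fun _ _ => v0).
move=> supp.
have prho : normc (p - g t) < rho.
  have := normc_triangle (f z) p (g t); rewrite -/(g t) in pz; lra.
have [cp|cp] := ltP 0 (sg * cross v (p - g t)).
  have [y [y1 fy]] := cov p prho cp.
  by have := supp y y1; rewrite fy leNgt cp.
(* If [p] is not on the covered side, its reflection in [g t] is. *)
have p'E : (g t + (-1)%:C * (p - g t)) - g t = (-1)%:C * (p - g t) by ring.
have [||y [y1 fy]] := cov (g t + (-1)%:C * (p - g t)).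
- by rewrite p'E normcZ normrN1 mul1r.
- rewrite p'E crossZr mulN1r mulrN oppr_gt0 lt_neqAle cp andbT mulf_neq0 //.
    by case: sgP => ->; rewrite ?oner_neq0 ?oppr_eq0 ?oner_neq0.
  exact: (pc 0%N).
have := supp y y1; rewrite fy p'E crossZr mulN1r mulrN oppr_le0 => cp'.
have /eqP := pc 0%N isT; apply.
have : sg * cross v (p - g t) = 0 by apply/eqP; rewrite eq_le cp cp'.
by case: sgP => ->; rewrite ?mul1r // mulN1r => /eqP; rewrite oppr_eq0 => /eqP.
Qed.

(** On the common line, with origin [g t] and unit [v], edge [i] runs from [- r] to [1 - r]. Without
    spikes the following collinear edges keep increasing this coordinate, so they do not return to
    [0]. *)
Lemma collinear_edges_neq i d t t' : (0 < d <= 2)%N ->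
  T i < t < T i.+1 -> T (i + d) < t' < T (i + d).+1 ->
  cross (g (T i.+1) - g (T i)) (g (T (i + d)) - g t) = 0 ->
  cross (g (T i.+1) - g (T i)) (g (T (i + d).+1) - g t) = 0 -> g t <> g t'.
Proof.
move=> d2 it it' c1 c2 gtt.
have [r [r01 gt]] := edge_param gT it; have [r' [r'01 gt']] := edge_param gT it'.
set v := g (T i.+1) - g (T i) in gt c1 c2.
have v0 : v != 0 by rewrite subr_eq0; apply/eqP/nesym/(edge_neq gT).
have coord w : cross v (w - g t) = 0 -> exists a : R, w = g t + a%:C * v.
  move=> cw; exists (complex.Re ((w - g t) / v)).
  have -> : (complex.Re ((w - g t) / v))%:C = (w - g t) / v.
    move: cw v0; rewrite /cross; case: (w - g t) (v) => a b [c e] /= h v0.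
    apply/eqP; rewrite eq_complex eqxx /=; apply/eqP.
    by rewrite mulrN mulrA mulrA -mulNr -mulrDl [X in X * _](_ : _ = 0) ?mul0r //; lra.
  by rewrite divfK // addrC subrK.
have [a aE] := coord _ c1; have [b bE] := coord _ c2.
have ab : (1 - r') * a + r' * b = 0.
  have : ((1 - r') * a + r' * b)%:C * v = 0.
    have -> : ((1 - r') * a + r' * b)%:C * v =
      g (T (i + d)) + r'%:C * (g (T (i + d).+1) - g (T (i + d))) - g t.
      by rewrite aE bE; ring.
    by rewrite -gt' -gtt subrr.
  by move/eqP; rewrite mulf_eq0 (negbTE v0) orbF => /eqP/complexI.
have iE : g (T i) = g t + (- r)%:C * v by rewrite gt; ring.
have i1E : g (T i.+1) = g t + (1 - r)%:C * v by rewrite gt /v; ring.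
have spike k (x y z : R) : g (T k) = g t + x%:C * v -> g (T k.+1) = g t + y%:C * v ->
    g (T k.+2) = g t + z%:C * v -> x != y -> 0 < (z - y) / (x - y) -> False.
  move=> kE k1E k2E xy c0; apply: (@no_spike _ _ _ _ gT gc gi k _ c0).
  rewrite kE k1E k2E.
  have -> : g t + z%:C * v - (g t + y%:C * v) = (z - y)%:C * v by ring.
  have -> : g t + x%:C * v - (g t + y%:C * v) = (x - y)%:C * v by ring.
  by rewrite mulrA -rmorphM /= divfK // subr_eq0.
have [d1|d1] := eqVneq d 1%N.
  rewrite d1 addn1 in aE bE.
  have aE' : a = 1 - r.
    apply/eqP; rewrite -subr_eq0; apply/eqP/(@complexI R).
    apply: (mulIf v0); rewrite mul0r rmorphB mulrBl.
    by apply/eqP; rewrite subr_eq0; apply/eqP/(addrI (g t)); rewrite -aE.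
  have b0 : b < 0 by nra.
  apply: (spike i _ _ _ iE i1E bE); first by rewrite lt_eqF //; lra.
  by rewrite nmulr_rgt0 ?invr_lt0; lra.
have dE : d = 2%N by lia.
rewrite dE addn2 in aE bE.
have ar : 1 - r < a.
  rewrite ltNge; apply/negP => ar.
  have [aE'|ane] := eqVneq a (1 - r).
    by case: (edge_neq gT (k := i.+1)); rewrite i1E aE aE'.
  apply: (spike i _ _ _ iE i1E aE); first by rewrite lt_eqF //; lra.
  have : a < 1 - r by rewrite lt_neqAle ane.
  by move=> ?; rewrite nmulr_rgt0 ?invr_lt0; lra.
have b0 : b < 0 by nra.
apply: (spike i.+1 _ _ _ i1E aE bE); first by rewrite lt_eqF.
by rewrite nmulr_rgt0 ?invr_lt0; lra.
Qed.

(** Neither half of the second edge enters the side covered along the first edge; as the common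
    point lies between the halves, both edges are on one line. *)
Lemma edges_neq i d t t' : (0 < d <= 2)%N ->
  T i < t < T i.+1 -> T (i + d) < t' < T (i + d).+1 -> g t <> g t'.
Proof.
move=> d2 it it' gtt.
have [sg [rho [sgP rho0 cov]]] := edge_covers_side gT fcont finj fopen it.
have [r' [r'01 gt']] := edge_param gT it'.
set v := g (T i.+1) - g (T i) in cov.
have h1 : sg * cross v (g (T (i + d)) - g t) <= 0.
  apply: (covers_side_half_edge cov rho0) => s s01; rewrite -/(g t) gtt gt'.
  by apply: (half_edge_start gT) => //; lra.
have h2 : sg * cross v (g (T (i + d).+1) - g t) <= 0.
  apply: (covers_side_half_edge cov rho0) => s s01; rewrite -/(g t) gtt gt'.
  by apply: (half_edge_end gT) => //; lra.
have h0 : (1 - r') * (sg * cross v (g (T (i + d)) - g t)) +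
    r' * (sg * cross v (g (T (i + d).+1) - g t)) = 0.
  have -> : forall A B : R, (1 - r') * (sg * A) + r' * (sg * B) =
    sg * ((1 - r') * A + r' * B) by move=> A B; ring.
  rewrite -!crossZr -crossDr.
  have -> : (1 - r')%:C * (g (T (i + d)) - g t) + r'%:C * (g (T (i + d).+1) - g t) =
    g (T (i + d)) + r'%:C * (g (T (i + d).+1) - g (T (i + d))) - g t by ring.
  by rewrite -gt' gtt subrr cross0r mulr0.
have sg0 : sg != 0 by case: sgP => ->; rewrite ?oppr_eq0 oner_neq0.
move: h0 h1 h2; set A := sg * cross _ _; set B := sg * cross _ _ => h0 h1 h2.
have A0 : A = 0 by nra.
have B0 : B = 0 by nra.
apply: (collinear_edges_neq d2 it it') gtt.
  by move/eqP: A0; rewrite mulf_eq0 (negbTE sg0) => /eqP.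
by move/eqP: B0; rewrite mulf_eq0 (negbTE sg0) => /eqP.
Qed.

Lemma circle_injective x y : normc x = 1 -> normc y = 1 -> f x = f y -> x = y.
Proof.
move=> x1 y1 fxy.
have [i [t [i_n /andP[it ti] xE]]] := circle_arc Tper x1.
have [j [t' [jn /andP[jt tj] yE]]] := circle_arc Tper y1.
wlog ij : x y x1 y1 fxy i t i_n it ti xE j t' jn jt tj yE / (i <= j)%N.
  move=> H; have [ij|/ltnW ij] := leqP i j; first exact: (H x y _ _ _ i t _ _ _ _ j t').
  by apply/esym; apply: (H y x _ _ _ j t' _ _ _ _ i t).
have gtt : g t = g t' by rewrite /g -xE -yE.
have [ijE|ijne] := eqVneq i j.
  rewrite -{j jn ij}ijE in jt tj.
  rewrite xE yE; congr cis.
  have [tE|tne] := eqVneq t (T i).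
    have [//|t'ne] := eqVneq t' (T i); first by move=> ->.
    exfalso; apply: (vertex_start_neq gT (k := i) (t := t')); last by rewrite -gtt tE.
    by rewrite lt_neqAle eq_sym t'ne jt.
  have it' : T i < t < T i.+1 by rewrite lt_neqAle eq_sym tne it.
  have [t'E|t'ne] := eqVneq t' (T i).
    by exfalso; case: (vertex_start_neq gT it'); rewrite gtt t'E.
  apply: (edge_inj gT it') => //.
  by rewrite lt_neqAle eq_sym t'ne jt.
exfalso.
have [d [d0 dn jE]] : exists d, [/\ (0 < d)%N, (d < n)%N & j = (i + d)%N].
  by exists (j - i)%N; split; lia.
have inE : (i + n = j + (n - d))%N by lia.
rewrite jE in jt tj inE.
have shift : T (i + d + (n - d)) = T i + 2 * pi by rewrite -inE Tper.
have shift1 : T (i + d + (n - d)).+1 = T i.+1 + 2 * pi by rewrite -inE -addSn Tper.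
have gper : g (t + 2 * pi) = g t by rewrite /g cisD2pi.
have [tE|tne] := eqVneq t (T i).
  have [t'E|t'ne] := eqVneq t' (T (i + d)).
    by apply: (@vertices_inj i d); rewrite ?d0 // -tE -t'E.
  have jt' : T (i + d) < t' < T (i + d).+1 by rewrite lt_neqAle eq_sym t'ne jt.
  apply: (@edge_vertex_neq _ (n - d) _ _ jt'); first lia.
  by rewrite -inE vertex_per -gtt tE.
have it' : T i < t < T i.+1 by rewrite lt_neqAle eq_sym tne it.
have [t'E|t'ne] := eqVneq t' (T (i + d)).
  by apply: (@edge_vertex_neq i d _ dn it'); rewrite gtt t'E.
have jt' : T (i + d) < t' < T (i + d).+1 by rewrite lt_neqAle eq_sym t'ne jt.
(* If [d > 2], then [n - d <= 2]: the roles are exchanged and the first edge is taken one turn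
   later. *)
have [d2|d2] := leqP d 2; first by apply: (@edges_neq i d t t'); rewrite ?d0.
apply: (@edges_neq (i + d) (n - d) t' (t + 2 * pi)) => //; first lia.
  by rewrite shift shift1 !ltrD2r.
by rewrite gper.
Qed.

End BoundaryInjective.

(** * Metric form of the immersion hypotheses *)

Section Immersions.
Context {R : realType} (f : R[i] -> R[i]).

Lemma local_homeomorphism_continuous :
  local_homeomorphism_on closed_unit_disk f -> disk_continuous f.
Proof.
move=> [/subspace_continuousP fc _] x x1 e e0.
have /closed_unit_diskP xD := x1.
have /cvg_normc/(_ e e0) := fc x xD.
rewrite near_withinE => /nbhs_normc[d d0 hd]; exists d => // y y1 yx.
by apply: hd => //; exact/closed_unit_diskP.
Qed.

Lemma local_homeomorphism_injective :
  local_homeomorphism_on closed_unit_disk f -> disk_locally_injective f.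
Proof.
move=> [_ fh] x x1; have /closed_unit_diskP xD := x1.
have [V /nbhs_normc[d d0 dV] [[_ inj _] _ _]] := fh x xD.
exists d => // y z y1 z1 yx zx; apply: inj; rewrite inE.
  by split; [exact: dV|exact/closed_unit_diskP].
by split; [exact: dV|exact/closed_unit_diskP].
Qed.

Lemma boundary_curve_continuous :
  disk_continuous f -> curve_continuous (fun t => f (cis t)).
Proof.
move=> fc t e e0; have n1 s : normc (cis s : R[i]) <= 1 by rewrite normc_cis.
have [d d0 hd] := fc (cis t) (n1 t) e e0.
have [d' d'0 hd'] := cis_continuous_dist t d0.
by exists d' => // t' t't; apply: hd => //; exact: hd'.
Qed.

Lemma boundary_curve_locally_injective :
  disk_locally_injective f -> curve_locally_injective (fun t => f (cis t)).
Proof.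
move=> fi t; have n1 s : normc (cis s : R[i]) <= 1 by rewrite normc_cis.
have [d d0 hd] := fi (cis t) (n1 t).
have [d' d'0 hd'] := cis_continuous_dist t d0.
have p0 := pi_gt0 R.
(* The bound [pi] keeps the two arguments less than one turn apart, where [cis] is injective. *)
exists (Num.min d' pi); first by rewrite lt_min d'0.
move=> s s'; rewrite !lt_min => /andP[st sp] /andP[s't s'p] /= fss.
apply: cis_inj; last by apply: hd => //; exact: hd'.
move: sp s'p; rewrite !ltr_norml; lra.
Qed.

End Immersions.

Theorem lemma4p1 (R : realType) (n : nat) (hn : (3 <= n <= 5)%N)
    (phi : R[i] -> R[i]) (hphi : immersed_ngon n phi) : simple_curve phi.
Proof.
have /andP[n3 n5] := hn.
have [[_ [f [[fh fo] fphi]]] sides] := hphi.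
have fc := local_homeomorphism_continuous fh.
have fi := local_homeomorphism_injective fh.
have fop := disk_open_map_of_orientation fc fi fo.
have gc := boundary_curve_continuous fc.
have gi := boundary_curve_locally_injective fi.
have phig t : phi (cis t) = f (cis t).
  by rewrite fphi // inE; exact/unit_circleP/normc_cis.
have [T gT] := polygon_of_n_sided (ltnW n3) phig gc sides.
move=> x y xS yS; rewrite -!fphi // => fxy.
move: xS yS; rewrite !inE => /unit_circleP x1 /unit_circleP y1.
exact: (circle_injective n5 n3 gT gc gi fc fi fop x1 y1).
Qed.
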